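(* Let $n\ge 20$ and let $U$ be a unicyclic graph of order $n$. Then $$\lambda_{\min}(U^c)\ \ge\ \lambda_{\min}\Big(\mathcal U\big(\lceil (n-2)/2\rceil,\ \lfloor (n-2)/2\rfloor\big)^c\Big),$$ with equality if and only if $U$ is isomorphic to $\mathcal U\big(\lceil (n-2)/2\rceil,\lfloor (n-2)/2\rfloor\big)$.
   Context: All graphs are simple and finite. For a graph $G$, $\lambda_{\min}(G)$ denotes the least eigenvalue of the adjacency matrix $A(G)$, and $G^c$ denotes the complement of $G$. A unicyclic graph is a connected graph containing exactly one cycle. $K_{1,m}$ is the star with $m$ edges; its vertex of degree $m$ is the center and the others are pendant vertices. $S_m^3$ denotes the graph of order $m$ obtained from the star $K_{1,m-1}$ by adding one edge between two of its pendant vertices. For integers $p\ge 1$ and $q\ge 3$, $\mathcal U(p,q)$ is the graph of order $p+q+2$ obtained from disjoint copies of $K_{1,p}$ and $S_{q+1}^3$ by adding one edge joining a pendant (degree-one) vertex of $K_{1,p}$ to a pendant (degree-one) vertex of $S_{q+1}^3$. *)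

(* Defs.v *)
From HB Require Import structures.
From mathcomp Require Import all_boot all_order all_algebra all_field.
Set Implicit Arguments. Unset Strict Implicit. Unset Printing Implicit Defensive.
Import Order.TTheory GRing.Theory Num.Theory.

Definition simple_graph (n : nat) (e : rel 'I_n) : Prop :=
  symmetric e /\ irreflexive e.

Definition gcompl (n : nat) (e : rel 'I_n) : rel 'I_n :=
  fun x y => (x != y) && ~~ e x y.

Definition adjmx (n : nat) (e : rel 'I_n) : 'M[algC]_n :=
  \matrix_(i, j) (((e i j : nat)%:R)%R : algC).

(* The multiset of eigenvalues of a square matrix: the roots (with
   multiplicity) of its characteristic polynomial over algC. *)
Definition spectrum (n : nat) (A : 'M[algC]_n) : seq algC :=
  sval (closed_field_poly_normal (char_poly A)).

(* Least eigenvalue: minimum of the spectrum (the spectrum of a real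
   symmetric matrix is real, hence totally ordered). *)
Definition lambda_min (n : nat) (A : 'M[algC]_n) : algC :=
  let s := spectrum A in \big[Num.min/head 0%R s]_(x <- s) x.

Definition lmin_graph (n : nat) (e : rel 'I_n) : algC := lambda_min (adjmx e).

Definition gconnected (n : nat) (e : rel 'I_n) : Prop :=
  forall x y, connect e x y.

Definition is_gcycle (n : nat) (e : rel 'I_n) (s : seq 'I_n) : bool :=
  [&& (3 <= size s)%N, uniq s & cycle e s].

(* The edge set of a cycle (edges as 2-element vertex sets); two cyclic
   sequences describe the same cycle iff they have the same edge set. *)
Definition cycle_edges (n : nat) (s : seq 'I_n) : {set {set 'I_n}} :=
  [set [set x; next s x] | x in s].

Definition unicyclic (n : nat) (e : rel 'I_n) : Prop :=
  gconnected e /\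
  exists C : {set {set 'I_n}},
    (exists s, is_gcycle e s /\ cycle_edges s = C) /\
    (forall s, is_gcycle e s -> cycle_edges s = C).

Definition gisomorphic (n : nat) (e1 e2 : rel 'I_n) : Prop :=
  exists f : 'I_n -> 'I_n, bijective f /\ forall x y, e2 (f x) (f y) = e1 x y.

(* U(p,q) on vertices 0..p+q+1:
   K_{1,p}: center 0, pendants 1..p;
   S^3_{q+1}: center p+1, pendants p+2..p+q+1, extra edge {p+q, p+q+1};
   joining edge {1, p+2} (1 is a pendant of K_{1,p}; p+2 is a degree-one
   vertex of S^3_{q+1} since q >= 3). *)
Definition Upq_dir (p q : nat) (i j : nat) : bool :=
  [|| (i == 0) && (1 <= j <= p),
      (i == p.+1) && (p.+2 <= j <= p + q + 1),
      (i == p + q) && (j == p + q + 1)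
    | (i == 1) && (j == p.+2)].

Definition Upq (p q : nat) : rel nat :=
  fun i j => Upq_dir p q i j || Upq_dir p q j i.

(* U(p,q) viewed as a graph on 'I_n (intended when n = p + q + 2). *)
Definition Ugraph (n p q : nat) : rel 'I_n := fun i j => Upq p q i j.

Definition Uext (n : nat) : rel 'I_n := @Ugraph n (uphalf (n - 2)) ((n - 2)./2).

(* Main.v *)
(** Since A(G^c) = J - I - A(G), the least eigenvalue of G^c is -1 - M(G), where
    M(G) is the maximum of (x^T A(G) x - (sum x)^2) / |x|^2 over real x.  Take a
    maximizer x for the unicyclic graph U and split its vertices into the
    nonnegative part P and the negative part N.  After deleting a suitable edge of
    its cycle, U is a spanning tree; rooting this tree at the largest entry c of P
    charges every edge inside P to its lower end, so these edges contribute at most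
    as much as a star centered at c, and likewise for N.  The edges between P and N
    contribute at most the product of the two entries closest to 0, and the deleted
    edge at most the product of two extreme entries of N.  Hence the form of U at
    x is at most the form of some U(p,q) at x, with p + q = n - 2.

    Completing squares reduces M |x|^2 minus the form of U(p,q) to a form in the
    entries at the two centers alone; it is nonnegative iff [threshold] is.  There
    p and q enter only through p + q and |q - p + 2/(M - 1)|, and for M > 3 the
    latter is minimal exactly at the balanced pair.  When P or N has at most three
    vertices the form is at most 3 |x|^2, while n >= 20 forces M(U(p,q)) > 3 for
    the balanced pair.  In the case of equality x is an eigenvector of U(p,q), its
    entries are strictly ordered, and all the edge estimates determine U. *)
Require Import Defs.
From HB Require Import structures.
From mathcomp Require Import all_boot all_order all_algebra all_field.
From mathcomp Require Import spectral.
From mathcomp Require Import ring lra zify.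
Import Order.TTheory GRing.Theory Num.Theory.
Local Open Scope ring_scope.
Set Implicit Arguments. Unset Strict Implicit. Unset Printing Implicit Defensive.

(** * Rooted trees *)

Section RootedTree.
Variable V : finType.
Implicit Types (T : rel V) (a b r : V).

Definition del_edge T a b : rel V :=
  fun u v => T u v && ~~ ((u == a) && (v == b) || (u == b) && (v == a)).

Lemma del_edge_sym T a b : symmetric T -> symmetric (del_edge T a b).
Proof. by move=> sT u v; rewrite /del_edge sT orbC (andbC (u == b)) (andbC (u == a)). Qed.

Lemma del_edgeC T a b : del_edge T a b =2 del_edge T b a.
Proof. by move=> u v; rewrite /del_edge orbC. Qed.

Variable T : rel V.
Hypotheses (symT : symmetric T) (conT : forall u v, connect T u v).
(** A tree is encoded as a connected graph all of whose edges are bridges; since [connect] is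
    reflexive, this also excludes loops. *)
Hypothesis bridgeT : forall a b, T a b -> ~~ connect (del_edge T a b) a b.

(* [up r a b]: in the tree [T] rooted at [r], [b] is the parent of [a]. *)
Definition up r a b := T a b && connect (del_edge T a b) r b.

Let csD a b := sym_connect_sym (del_edge_sym a b symT).

(** Otherwise the component of [r] after deleting the edge contains neither of its ends, so it is
    closed under [T], against connectedness. *)
Lemma up_total r a b : T a b -> up r a b || up r b a.
Proof.
move=> Tab; rewrite /up (symT b a) Tab /= (eq_connect (del_edgeC T b a)).
apply/negPn/negP; rewrite negb_or => /andP[nb na].
have cl : closed T [pred v | connect (del_edge T a b) r v].
  move=> u v Tuv; rewrite !inE.
  case E: ((u == a) && (v == b) || (u == b) && (v == a)).
    by case/orP: E => /andP[/eqP-> /eqP->]; rewrite (negbTE na) (negbTE nb).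
  have Duv : del_edge T a b u v by rewrite /del_edge Tuv E.
  by rewrite (same_connect_r (csD a b) (connect1 Duv)).
have := closed_connect cl (conT r a); rewrite !inE connect0 => H.
by rewrite -H in na.
Qed.

Lemma up_exclusive r a b : up r a b -> ~~ up r b a.
Proof.
move=> /andP[Tab rb]; apply/negP => /andP[_]; rewrite (eq_connect (del_edgeC T b a)) => ra.
by have /negP[] := bridgeT Tab; apply: connect_trans rb; rewrite (csD a b).
Qed.

Lemma up_root r b : ~~ up r r b.
Proof. by apply/negP => /andP[Trb rb]; have /negP := bridgeT Trb. Qed.

(** A path from [r] to [b] without the edge [a b] avoids [a], hence survives the deletion of [a b'].
    Extended by the edge [b a], it links [b'] to [a] through [r], although [a b'] is a bridge. *)
Lemma up_unique r a b b' : up r a b -> up r a b' -> b = b'.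
Proof.
move=> /andP[Tab rb] /andP[Tab' rb']; apply/eqP/negPn/negP => bb'.
have nra : ~~ connect (del_edge T a b) r a.
  apply/negP => ra; have /negP[] := bridgeT Tab.
  by apply: connect_trans rb; rewrite (csD a b).
(* Closedness of this set replaces an induction along the path from [r] to [b]. *)
have cl : closed (del_edge T a b)
    [pred v | connect (del_edge T a b') r v || ~~ connect (del_edge T a b) r v].
  apply: (intro_closed (csD a b)) => u v Duv; rewrite !inE.
  rewrite -(same_connect_r (csD a b) (connect1 Duv)) => /orP[ru'|->]; last by rewrite orbT.
  case ru: (connect (del_edge T a b) r u) => /=; last by rewrite orbT.
  have rv : connect (del_edge T a b) r v by apply: connect_trans ru (connect1 Duv).
  have ua : u != a by apply: contraTneq ru => ->.
  have va : v != a by apply: contraTneq rv => ->.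
  rewrite orbF; apply: connect_trans ru' (connect1 _).
  by case/andP: Duv => Tuv _; rewrite /del_edge Tuv (negbTE ua) (negbTE va) andbF.
have := closed_connect cl rb; rewrite !inE connect0 rb orbF => /esym rb2.
have /negP[] := bridgeT Tab'.
apply: connect_trans rb'; rewrite (csD a b'); apply: connect_trans rb2 (connect1 _).
have ba : b != a by apply: contraTneq (bridgeT Tab) => <-; rewrite connect0.
by rewrite /del_edge symT Tab (negbTE bb') (negbTE ba).
Qed.

Lemma sum_tree (R : comPzRingType) (r : V) (F : V -> V -> R) :
  (forall a b, F a b = F b a) ->
  \sum_a \sum_b (T a b)%:R * F a b = 2 * \sum_a \sum_b (up r a b)%:R * F a b.
Proof.
move=> sF; rewrite mulr_natl mulr2n [X in _ = _ + X]exchange_big -big_split /=.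
apply: eq_bigr => a _; rewrite -big_split /=; apply: eq_bigr => b _.
rewrite (sF b a) -mulrDl -natrD; congr (_%:R * _).
case Tab: (T a b); last by rewrite /up (symT b a) Tab.
have := up_total r Tab; case/orP => H; have := up_exclusive H; rewrite H.
  by move/negbTE->.
by move/negbTE->.
Qed.

Section SideBound.
Variables (R : realDomainType) (x : V -> R) (P : {set V}) (c : V).
Hypotheses (x0 : forall a, a \in P -> 0 <= x a) (cP : c \in P).
Hypothesis xc : forall a, a \in P -> x a <= x c.

(** A vertex has at most one parent, the root [c] has none, and no entry on [P] exceeds [x c]. If
    the parent lies outside [P], the left side is 0. *)
Lemma side_bound_term a : a \in P ->
  \sum_(b in P) (up c a b)%:R * (x a * x b) <= if a == c then 0 else x a * x c.
Proof.
move=> aP; case: eqP => [->|ac].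
  by rewrite big1 // => b _; rewrite (negbTE (up_root c b)) mul0r.
case: (pickP (fun b => up c a b && (b \in P))) => [b /andP[ub bP]|nob]; last first.
  rewrite big1 ?mulr_ge0 ?x0 // => b bP; have := nob b; rewrite bP andbT => ->.
  by rewrite mul0r.
rewrite (bigD1 b) //= big1 ?addr0 => [|b' /andP[_ b'b]].
  by rewrite ub mul1r ler_wpM2l ?x0 ?xc.
case ub': (up c a b'); last by rewrite mul0r.
by move: b'b; rewrite (up_unique ub' ub) eqxx.
Qed.

Lemma sum_sideE :
  \sum_(a in P) \sum_(b in P) (T a b)%:R * (x a * x b) =
  2 * \sum_(a in P) \sum_(b in P) (up c a b)%:R * (x a * x b).
Proof.
have E (Q : rel V) : \sum_(a in P) \sum_(b in P) (Q a b)%:R * (x a * x b) =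
  \sum_a \sum_b (Q a b)%:R * (((a \in P) && (b \in P))%:R * (x a * x b)).
  rewrite big_mkcond; apply: eq_bigr => a _; rewrite big_mkcond /=.
  case: (a \in P) => /=; last by rewrite big1 // => b _; rewrite mul0r mulr0.
  by apply: eq_bigr => b _; case: (b \in P); rewrite ?mul1r ?mul0r ?mulr0.
by rewrite !E (sum_tree c) // => a b; rewrite andbC (mulrC (x a)).
Qed.

Lemma sum_star_if : \sum_(a in P) (if a == c then 0 else x a * x c) =
  x c * \sum_(a in P | a != c) x a.
Proof.
rewrite big_distrr /= [LHS]big_mkcond [RHS]big_mkcond; apply: eq_bigr => a _.
by case: (a \in P) => //=; case: eqP => //= _; rewrite mulrC.
Qed.

Lemma side_bound :
  \sum_(a in P) \sum_(b in P) (T a b)%:R * (x a * x b) <=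
  2 * (x c * \sum_(a in P | a != c) x a).
Proof.
rewrite sum_sideE -sum_star_if ler_wpM2l ?ler0n //.
by apply: ler_sum => a; apply: side_bound_term.
Qed.

(** Equality of the sums forces equality at every vertex other than [c]: its parent lies in [P] and
    has the entry [x c], so it is [c] itself. Any further edge would give some vertex a second
    parent. *)
Lemma side_bound_eq :
  (forall a, a \in P -> 0 < x a) -> (forall a, a \in P -> a != c -> x a < x c) ->
  \sum_(a in P) \sum_(b in P) (T a b)%:R * (x a * x b) =
  2 * (x c * \sum_(a in P | a != c) x a) ->
  forall a b, a \in P -> b \in P -> T a b = (a == c) (+) (b == c).
Proof.
move=> xp xlt; have n2 : 2 != 0 :> R by rewrite pnatr_eq0.
rewrite sum_sideE -sum_star_if => /(mulfI n2) E.
have upc a : a \in P -> a != c -> up c a c.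
  move=> aP ac; have H a' (a'P : a' \in P) := leif_eq (side_bound_term a'P).
  have [_] := leif_sum H; rewrite E eqxx => /esym/forallP/(_ a).
  rewrite aP (negbTE ac) /= => /eqP Ea.
  case: (pickP (fun b => up c a b && (b \in P))) => [b /andP[ub bP]|nob]; last first.
    move: Ea; rewrite big1 => [/esym/eqP|b bP]; last first.
      by have := nob b; rewrite bP andbT => ->; rewrite mul0r.
    by rewrite mulf_eq0 !gt_eqF ?xp.
  move: Ea; rewrite (bigD1 b) //= big1 ?addr0 => [|b' /andP[_ b'b]]; last first.
    case ub': (up c a b'); last by rewrite mul0r.
    by move: b'b; rewrite (up_unique ub' ub) eqxx.
  rewrite ub mul1r => /(mulfI (lt0r_neq0 (xp a aP))) Ebc.
  have [bc|bc] := eqVneq b c; first by rewrite -{2}bc.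
  by have := xlt b bP bc; rewrite Ebc ltxx.
move=> a b aP bP; have [->|ac] := eqVneq a c; have [->|bc] := eqVneq b c => //=.
- by apply/negP => Tcc; have := bridgeT Tcc; rewrite connect0.
- by rewrite symT; have /andP[] := upc b bP bc.
- by have /andP[] := upc a aP ac.
apply/negP => /(up_total c)/orP[] U.
  by move: bc; rewrite (up_unique U (upc a aP ac)) eqxx.
by move: ac; rewrite (up_unique U (upc b bP bc)) eqxx.
Qed.

End SideBound.
End RootedTree.

(** * Spanning trees of unicyclic graphs *)

Section SpanningTree.
Variables (n : nat) (e : rel 'I_n).
Hypothesis sg : simple_graph e.
Let symE : symmetric e. Proof. by case: sg. Qed.
Let irrE : irreflexive e. Proof. by case: sg. Qed.

Lemma is_gcycle_rot k s : is_gcycle e (rot k s) = is_gcycle e s.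
Proof. by rewrite /is_gcycle size_rot rot_uniq rot_cycle. Qed.

(** The rest of the cycle joins [y] to [x]: after its first edge it never meets [y] again, so it
    does not use the deleted edge. *)
Lemma cycle_connect_del x y p :
  is_gcycle e [:: x, y & p] -> connect (del_edge e x y) x y.
Proof.
case: p => [|z p] /and3P[] // _ U C.
have yNx : y != x by move: U; rewrite /= !inE !negb_or eq_sym => /andP[/and3P[]].
have zNx : z != x by move: U; rewrite /= !inE !negb_or eq_sym => /andP[/and3P[_ /[1! eq_sym]]].
have zNy : z != y by move: U; rewrite /= !inE !negb_or => /and3P[_ /andP[/[1! eq_sym]]].
have sD := del_edge_sym x y symE.
rewrite (sym_connect_sym sD); apply: (@connect_trans _ _ z).
  apply: connect1; move: C => /= /and3P[_ eyz _].
  by rewrite /del_edge eyz (negbTE zNx) (negbTE yNx) /= andbF.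
apply/connectP; exists (rcons p x); last by rewrite last_rcons.
have yN : y \notin z :: rcons p x.
  by move: U; rewrite /= !inE mem_rcons !inE !negb_or yNx => /and3P[_ /andP[->]] ->.
move: C => /= /and3P[_ _]; elim: (rcons p x) (z) yN => //= v q IH u.
rewrite !inE !negb_or => /and3P[yu yv yq] /andP[euv pq].
rewrite IH ?inE ?negb_or ?yv //= /del_edge euv /=.
by rewrite (eq_sym v y) (eq_sym u y) (negbTE yu) (negbTE yv) andbF.
Qed.

(** Three consecutive edges of the cycle cannot all fail: failing edges stay on one side of [P] and
    contain the center of that side, but a vertex lies on at most two edges of a cycle. *)
Lemma good_cycle_edge (P : {set 'I_n}) c d s : c \in P -> d \notin P ->
  is_gcycle e s -> exists x y p, is_gcycle e [:: x, y & p] /\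
    cycle_edges [:: x, y & p] = cycle_edges s /\
   (((x \in P) != (y \in P)) || [&& x != c, x != d, y != c & y != d]).
Proof.
move=> cP dP cs; pose good x y := ((x \in P) != (y \in P)) ||
  [&& x != c, x != d, y != c & y != d].
suff [k [x [y [p [E gxy]]]]] : exists k x y p, rot k s = [:: x, y & p] /\ good x y.
  exists x, y, p; rewrite -E is_gcycle_rot; split=> //; split=> //.
  have us : uniq s by case/and3P: cs.
  rewrite /cycle_edges; apply/setP => A; apply/imsetP/imsetP => -[v vs ->]; exists v;
    by rewrite ?mem_rot ?next_rot // -(mem_rot k).
case: s cs => [|x0 [|x1 [|x2 p]]] /and3P[] // _ U _.
(* [head x0 p] is the fourth vertex met, which is [x0] again when the cycle is a triangle. *)
have [n01 n02 n12 n13] : [/\ x0 != x1, x0 != x2, x1 != x2 & x1 != head x0 p].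
  move: U; rewrite /= !inE !negb_or => /and4P[/and3P[n01 n02 _] /andP[n12 n1p] _ _].
  split=> //; case: p n1p => [_ /=|u p] /=; first by rewrite eq_sym.
  by rewrite inE negb_or => /andP[].
have [g|b1] := boolP (good x0 x1); first by exists 0%N, x0, x1, (x2 :: p); rewrite rot0.
have [g|b2] := boolP (good x1 x2).
  by exists 1%N, x1, x2, (rcons p x0); rewrite rot1_cons.
have [g|b3] := boolP (good x2 (head x0 p)).
  exists 2%N, x2, (head x0 p), (behead (p ++ [:: x0; x1])); split=> //.
  by rewrite /rot /=; case: (p).
move: b1 b2 b3; rewrite /good; set x3 := head x0 p in n13 *.
rewrite !negb_or !negbK => /andP[/eqP s01 b1] /andP[/eqP s12 b2] /andP[/eqP s23 b3].
exfalso; case x0P: (x0 \in P).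
  have nd x : x \in P -> x != d by apply: contraTneq => ->.
  move: b1 b2 b3; rewrite !nd -?s23 -?s12 -?s01 ?x0P // !andbT.
  have [E|_] := eqVneq x1 c; rewrite /=; last first.
    rewrite andbT negbK => /eqP E; have [E2|//] := eqVneq x2 c.
    by rewrite E E2 eqxx in n02.
  by rewrite -E (eq_sym x2) n12 /= (eq_sym x3) n13.
have nc x : x \in P = false -> x != c by apply: contraFneq => ->.
move: b1 b2 b3; rewrite !nc -?s23 -?s12 -?s01 ?x0P // /=.
have [E|_] := eqVneq x1 d; rewrite /=; last first.
  rewrite andbT negbK => /eqP E; have [E2|//] := eqVneq x2 d.
  by rewrite E E2 eqxx in n02.
by rewrite -E (eq_sym x2) n12 /= (eq_sym x3) n13.
Qed.

(** The deleted edge lies on the cycle, so connectedness survives. A remaining edge that is not a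
    bridge would close a cycle avoiding the edge [x y], whereas all cycles have the same edge set,
    which contains it. *)
Lemma unicyclic_spanning_tree (P : {set 'I_n}) c d : unicyclic e ->
  c \in P -> d \notin P ->
  exists x y, [/\ e x y,
    ((x \in P) != (y \in P)) || [&& x != c, x != d, y != c & y != d],
    forall a b, connect (del_edge e x y) a b &
    forall a b, del_edge e x y a b ->
      ~~ connect (del_edge (del_edge e x y) a b) a b].
Proof.
move=> [conE [C [[s [cs <-]] unq]]] cP dP.
have [x [y [p [cyc [Ep good]]]]] := good_cycle_edge cP dP cs.
exists x, y; split=> //.
- by case/and3P: cyc => _ _ /= /andP[].
- have sD := del_edge_sym x y symE; move=> a b; move: (conE a b).
  apply: connect_sub => u v euv.
  case E: ((u == x) && (v == y) || (u == y) && (v == x)).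
    have cxy := cycle_connect_del cyc.
    by case/orP: E => /andP[/eqP-> /eqP->] //; rewrite (sym_connect_sym sD).
  by apply: connect1; rewrite /del_edge euv E.
move=> a b Tab; apply/negP => /connectP[q0 pq0 Eb].
case/shortenP: pq0 Eb => q pq uq _ Eb.
have eab : e a b by case/andP: Tab.
(* The path from [a] to [b] is not a single edge, because that edge is deleted. *)
have sq : (3 <= size (a :: q))%N.
  case: q pq Eb {uq} => [_ /= Eb|u [|v q]] //=; first by rewrite Eb irrE in eab.
  by move=> /andP[/andP[_]] /[swap] _ /[swap] ->; rewrite !eqxx.
have cT : cycle (del_edge e x y) (a :: q).
  rewrite /= rcons_path -Eb del_edge_sym // Tab andbT.
  by apply: sub_path pq => u v /andP[].
have : is_gcycle e (a :: q).
  rewrite /is_gcycle sq uq /=; apply: sub_path cT => u v /andP[] //.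
move=> /unq; rewrite -Ep => /setP/(_ [set x; y]).
have -> : [set x; y] \in cycle_edges [:: x, y & p].
  by apply/imsetP; exists x; rewrite ?mem_head //= eqxx.
case/imsetP => v vq Ev.
have := next_cycle cT vq; rewrite /del_edge => /andP[evn /negP[]].
have [xNy vNn] : x != y /\ v != next (a :: q) v.
  split; first by case/and3P: cyc => _ + _; rewrite /= !inE negb_or => /andP[/andP[]].
  by apply: contraTneq evn => <-; rewrite irrE.
have : v \in [set x; y] by rewrite Ev set21.
have : next (a :: q) v \in [set x; y] by rewrite Ev set22.
move: vNn; rewrite !inE; move: (next _ v) => w.
by move=> vw /orP[]/eqP Ew /orP[]/eqP Evv; move: vw; rewrite Ew Evv ?eqxx ?orbT.
Qed.
End SpanningTree.

(** * Double stars and their forms *)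

Section Forms.
Variables (R : realFieldType) (n : nat).
Implicit Types (e : rel 'I_n) (x : 'I_n -> R) (P : {set 'I_n}).

(* On real vectors, [- |x|^2 - qf e x] is the quadratic form of the adjacency
   matrix of the complement of [e]. *)
Definition qf e x : R :=
  \sum_i \sum_j (e i j)%:R * (x i * x j) - (\sum_i x i) ^+ 2.

Definition sqnorm x : R := \sum_i x i ^+ 2.

Definition double_star_dir P (c u d w t1 t2 : 'I_n) : rel 'I_n := fun a b =>
  [|| (a == c) && ((b \in P) && (b != c)), (a == d) && ((b \notin P) && (b != d)),
      (a == t1) && (b == t2) | (a == u) && (b == w)].

(* The graph U(p,q) with the vertices of its K_{1,p} forming the set [P]:
   [c], [d] are the centers, [u], [w] the ends of the joining edge and
   [t1], [t2] those of the edge added to the second star. *)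
Definition double_star P (c u d w t1 t2 : 'I_n) : rel 'I_n := fun a b =>
  double_star_dir P c u d w t1 t2 a b || double_star_dir P c u d w t1 t2 b a.

Definition double_star_ok P (c u d w t1 t2 : 'I_n) :=
  [&& c \in P, u \in P, u != c, all [predC P] [:: d; w; t1; t2] &
      uniq [:: d; w; t1; t2]].

(** This is [qf] of the double star, with the edges of the two stars, the triangle edge and the
    joining edge summed separately. *)
Definition phi P (c u d w t1 t2 : 'I_n) x : R :=
  2 * (x c * \sum_(i in P | i != c) x i) +
  2 * (x d * \sum_(i in ~: P | i != d) x i) +
  2 * (x t1 * x t2) + 2 * (x u * x w) - (\sum_i x i) ^+ 2.

Lemma sum_pair_point (c : 'I_n) (B : pred 'I_n) (F : 'I_n -> 'I_n -> R) :
  \sum_a \sum_b ((a == c) && B b)%:R * F a b = \sum_(b | B b) F c b.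
Proof.
rewrite (bigD1 c) //= [X in _ + X]big1 ?addr0 => [|a ac]; last first.
  by rewrite big1 // => b _; rewrite (negbTE ac) mul0r.
rewrite [RHS]big_mkcond; apply: eq_bigr => b _; rewrite eqxx /=.
by case: (B b); rewrite ?mul1r ?mul0r.
Qed.

Lemma sum_sym_dir (D : rel 'I_n) x :
  (forall a b, D a b -> D b a = false) ->
  \sum_a \sum_b (D a b || D b a)%:R * (x a * x b) =
  2 * \sum_a \sum_b (D a b)%:R * (x a * x b).
Proof.
move=> aD; rewrite mulr_natl mulr2n [X in _ = _ + X]exchange_big -big_split /=.
apply: eq_bigr => a _; rewrite -big_split /=; apply: eq_bigr => b _.
rewrite (mulrC (x b)) -mulrDl -natrD; congr (_%:R * _).
by have := aD a b; case: (D a b) => [->|] //; case: (D b a).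
Qed.

(** The eight kinds of vertices; each determines all seven membership tests at once, so that
    adjacency questions reduce to computation. *)
Variant double_star_spec P c u d w t1 t2 (v : 'I_n) :
    bool -> bool -> bool -> bool -> bool -> bool -> bool -> Type :=
  | DScenter1 of v = c : double_star_spec P c u d w t1 t2 v true true false false false false false
  | DSjoin1 of v = u : double_star_spec P c u d w t1 t2 v true false true false false false false
  | DSleaf1 : double_star_spec P c u d w t1 t2 v true false false false false false false
  | DScenter2 of v = d : double_star_spec P c u d w t1 t2 v false false false true false false false
  | DSjoin2 of v = w : double_star_spec P c u d w t1 t2 v false false false false true false false
  | DStri1 of v = t1 : double_star_spec P c u d w t1 t2 v false false false false false true false
  | DStri2 of v = t2 : double_star_spec P c u d w t1 t2 v false false false false false false true
  | DSleaf2 : double_star_spec P c u d w t1 t2 v false false false false false false false.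

Lemma double_starP P c u d w t1 t2 v : double_star_ok P c u d w t1 t2 ->
  double_star_spec P c u d w t1 t2 v
    (v \in P) (v == c) (v == u) (v == d) (v == w) (v == t1) (v == t2).
Proof.
case/and5P => cP uP uc /and5P[/= dP wP t1P t2P _] /and4P[].
rewrite /= !inE !negb_or => /and3P[dw dt1 dt2] /andP[wt1 wt2] t12 _.
have nP a : a \notin P -> (a == c = false) * (a == u = false).
  by move=> aP; split; apply: contraNF aP => /eqP->.
have Pn a : a \in P -> [/\ a == d = false, a == w = false, a == t1 = false & a == t2 = false].
  by move=> aP; split; apply: contraTF aP => /eqP->.
have [->|vc] := eqVneq v c.
  by have [-> -> -> ->] := Pn c cP; rewrite cP eq_sym (negbTE uc); constructor.
have [->|vu] := eqVneq v u.
  by have [-> -> -> ->] := Pn u uP; rewrite uP; constructor.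
have [vP|vP] := boolP (v \in P).
  by have [-> -> -> ->] := Pn v vP; constructor.
have [->|vd] := eqVneq v d.
  by rewrite (negbTE dw) (negbTE dt1) (negbTE dt2); constructor.
have [->|vw] := eqVneq v w.
  by rewrite (negbTE wt1) (negbTE wt2); constructor.
have [->|vt1] := eqVneq v t1; first by rewrite (negbTE t12); constructor.
by have [->|vt2] := eqVneq v t2; constructor.
Qed.

Lemma qf_double_star P c u d w t1 t2 x : double_star_ok P c u d w t1 t2 ->
  qf (double_star P c u d w t1 t2) x = phi P c u d w t1 t2 x.
Proof.
move=> ok; rewrite /qf /phi sum_sym_dir => [|a b]; last first.
  rewrite /double_star_dir.
  by case: (double_starP a ok) => [_|_||_|_|_|_|]; case: (double_starP b ok).
congr (_ - _).
(* The four clauses of [double_star_dir] exclude each other, so its indicator is the sum of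
   theirs. *)
have E a b : (double_star_dir P c u d w t1 t2 a b)%:R * (x a * x b) =
  ((a == c) && ((b \in P) && (b != c)))%:R * (x a * x b) +
  ((a == d) && ((b \in ~: P) && (b != d)))%:R * (x a * x b) +
  ((a == t1) && (b == t2))%:R * (x a * x b) +
  ((a == u) && (b == w))%:R * (x a * x b).
  rewrite -!mulrDl -!natrD; congr (_%:R * _); rewrite /double_star_dir inE.
  by case: (double_starP a ok) => [_|_||_|_|_|_|]; case: (double_starP b ok).
under eq_bigr => a _ do (under eq_bigr => b _ do rewrite E); rewrite -!mulrDr.
under eq_bigr => a _ do rewrite !big_split /=.
by rewrite !big_split /= !sum_pair_point !big_distrr /= !big_pred1_eq.
Qed.

Lemma sum_split_sides (T : rel 'I_n) P x : symmetric T ->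
  \sum_a \sum_b (T a b)%:R * (x a * x b) =
  \sum_(a in P) \sum_(b in P) (T a b)%:R * (x a * x b) +
  \sum_(a in ~: P) \sum_(b in ~: P) (T a b)%:R * (x a * x b) +
  2 * \sum_(a in P) \sum_(b in ~: P) (T a b)%:R * (x a * x b).
Proof.
move=> sT; have E (F : 'I_n -> R) : \sum_a F a = \sum_(a in P) F a + \sum_(a in ~: P) F a.
  by rewrite (bigID (mem P)) /=; congr (_ + _); apply: eq_bigl => a; rewrite inE.
have S (A : {set 'I_n}) (F : 'I_n -> 'I_n -> R) :
    \sum_(a in A) \sum_b F a b =
    \sum_(a in A) \sum_(b in P) F a b + \sum_(a in A) \sum_(b in ~: P) F a b.
  by rewrite -big_split; apply: eq_bigr => a _; exact: E.
rewrite E !S.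
suff -> : \sum_(a in ~: P) \sum_(b in P) (T a b)%:R * (x a * x b) =
  \sum_(a in P) \sum_(b in ~: P) (T a b)%:R * (x a * x b) by ring.
rewrite exchange_big /=; apply: eq_bigr => a _; apply: eq_bigr => b _.
by rewrite sT (mulrC (x a)).
Qed.

Lemma sum_del_edge e f g x : simple_graph e -> e f g ->
  \sum_a \sum_b (e a b)%:R * (x a * x b) =
  \sum_a \sum_b (del_edge e f g a b)%:R * (x a * x b) + 2 * (x f * x g).
Proof.
move=> [sE iE] efg; have fg : f != g by apply: contraTneq efg => ->; rewrite iE.
have E a b : (e a b)%:R * (x a * x b) = (del_edge e f g a b)%:R * (x a * x b) +
  ((a == f) && (b == g))%:R * (x a * x b) + ((a == g) && (b == f))%:R * (x a * x b).
  rewrite -!mulrDl -!natrD; congr (_%:R * _); rewrite /del_edge.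
  have [->|af] := eqVneq a f; have [->|bg] := eqVneq b g; rewrite /= ?andbF ?andbT ?orbF ?addn0 //=.
  - by rewrite efg (negbTE fg).
  - by rewrite (negbTE fg) andbT addn0.
  - by have [->|] := eqVneq a g; rewrite /= ?(eq_sym g) ?(negbTE fg) ?andbT ?addn0.
  have [->|] := eqVneq a g; have [->|] := eqVneq b f; rewrite /= ?andbT ?addn0 //.
  by rewrite sE efg.
under eq_bigr => a _ do (under eq_bigr => b _ do rewrite E).
under eq_bigr => a _ do rewrite !big_split /=.
rewrite !big_split /= !sum_pair_point !big_pred1_eq; ring.
Qed.

End Forms.

(** * Bounding the form of a unicyclic graph *)

Section SignedTree.
Variables (R : realFieldType) (n : nat) (T : rel 'I_n) (x : 'I_n -> R).
Variables (P : {set 'I_n}) (c d : 'I_n).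
Hypotheses (symT : symmetric T) (conT : forall a b, connect T a b).
Hypothesis bridgeT : forall a b, T a b -> ~~ connect (del_edge T a b) a b.
Hypotheses (cP : c \in P) (dP : d \notin P).
Hypotheses (xP : forall a, a \in P -> 0 <= x a) (xN : forall a, a \notin P -> x a <= 0).
Hypotheses (xc : forall a, a \in P -> x a <= x c).
Hypotheses (xd : forall a, a \notin P -> x d <= x a).

Lemma crossing_edge : exists a b, [/\ a \in P, b \notin P & T a b].
Proof.
case: (pickP (fun p : 'I_n * 'I_n => [&& p.1 \in P, p.2 \notin P & T p.1 p.2])).
  by case=> a b /= /and3P[]; exists a, b.
move=> H; have cl : closed T (mem P).
  apply: (intro_closed (sym_connect_sym symT)) => a b Tab aP.
  by apply/negPn/negP => bP; have := H (a, b); rewrite /= aP bP Tab.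
by have := closed_connect cl (conT c d); rewrite cP (negbTE dP).
Qed.

Lemma pos_side_bound :
  \sum_(a in P) \sum_(b in P) (T a b)%:R * (x a * x b) <=
  2 * (x c * \sum_(a in P | a != c) x a).
Proof. exact: side_bound. Qed.

Lemma neg_sumE (F : 'I_n -> 'I_n -> R) :
  \sum_(a in ~: P) \sum_(b in ~: P) F a b * (- x a * - x b) =
  \sum_(a in ~: P) \sum_(b in ~: P) F a b * (x a * x b).
Proof. by apply: eq_bigr => a _; apply: eq_bigr => b _; rewrite mulrNN. Qed.

Lemma neg_starE :
  - x d * (\sum_(a in ~: P | a != d) - x a) = x d * \sum_(a in ~: P | a != d) x a.
Proof. by rewrite sumrN mulrNN. Qed.

(** This is [side_bound] for [- x] on the complement of [P]. *)
Lemma neg_side_bound :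
  \sum_(a in ~: P) \sum_(b in ~: P) (T a b)%:R * (x a * x b) <=
  2 * (x d * \sum_(a in ~: P | a != d) x a).
Proof.
have dN : d \in ~: P by rewrite inE.
have xN' a : a \in ~: P -> 0 <= - x a by rewrite inE oppr_ge0; apply: xN.
have xd' a : a \in ~: P -> - x a <= - x d by rewrite inE lerN2; apply: xd.
by have := side_bound symT conT bridgeT xN' dN xd'; rewrite neg_sumE neg_starE.
Qed.

Lemma cross_le0 a b : a \in P -> b \in ~: P -> (T a b)%:R * (x a * x b) <= 0.
Proof.
by rewrite inE => aP bP; rewrite mulr_ge0_le0 ?ler0n // mulr_ge0_le0 ?xP ?xN.
Qed.

(** All crossing terms are nonpositive, so a single one of them bounds their sum from above. *)
Lemma cross_le_edge a b : a \in P -> b \notin P -> T a b ->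
  \sum_(a in P) \sum_(b in ~: P) (T a b)%:R * (x a * x b) <= x a * x b.
Proof.
move=> aP bP Tab; rewrite (bigD1 a) //= (bigD1 b) ?inE //= Tab mul1r.
rewrite -[leRHS]addr0 -addrA lerD2l -[leRHS]addr0 lerD // sumr_le0 // => i /andP[iP _].
  by apply: cross_le0; rewrite // inE in iP *.
by apply: sumr_le0 => j jP; apply: cross_le0.
Qed.

Lemma cross_sum_le0 : \sum_(a in P) \sum_(b in ~: P) (T a b)%:R * (x a * x b) <= 0.
Proof. by apply: sumr_le0 => a aP; apply: sumr_le0 => b bP; apply: cross_le0. Qed.

Lemma signed_tree_bound :
  \sum_a \sum_b (T a b)%:R * (x a * x b) <=
  2 * (x c * \sum_(a in P | a != c) x a) + 2 * (x d * \sum_(a in ~: P | a != d) x a).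
Proof.
rewrite (sum_split_sides P x symT).
have := cross_sum_le0; have := pos_side_bound; have := neg_side_bound; lra.
Qed.

End SignedTree.

Section Products.
Variable R : realFieldType.
Implicit Types a b u w s t : R.

Lemma opp_mul_le a b u w : 0 <= u -> u <= a -> b <= 0 -> b <= w -> a * b <= u * w.
Proof. nra. Qed.

Lemma opp_mul_ltl a b u w : 0 < u -> u < a -> b < 0 -> b <= w -> a * b < u * w.
Proof. nra. Qed.

Lemma opp_mul_ltr a b u w : 0 < u -> u <= a -> b < 0 -> b < w -> a * b < u * w.
Proof. nra. Qed.

Lemma neg_mul_le a b s t : a <= 0 -> t <= 0 -> s <= a -> t <= b -> a * b <= s * t.
Proof. nra. Qed.

Lemma neg_mul_lt a b s t : a <= 0 -> t < 0 -> s < a -> t <= b -> a * b < s * t.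
Proof. nra. Qed.

End Products.

Section UnicyclicBound.
Variables (R : realFieldType) (n : nat) (e : rel 'I_n) (x : 'I_n -> R).
Variables (P : {set 'I_n}) (c u d w t1 t2 f g : 'I_n).
Hypotheses (sg : simple_graph e) (ok : double_star_ok P c u d w t1 t2).
Let T := del_edge e f g.
Hypotheses (efg : e f g) (conT : forall a b, connect T a b).
Hypothesis bridgeT : forall a b, T a b -> ~~ connect (del_edge T a b) a b.
Hypothesis fg_pos : ((f \in P) != (g \in P)) \/
  [/\ f \notin P, g \notin P, f != d & g != d].
Hypotheses (xP : forall a, a \in P -> 0 <= x a) (xN : forall a, a \notin P -> x a <= 0).
Hypotheses (xc : forall a, a \in P -> x a <= x c).
Hypotheses (xd : forall a, a \notin P -> x d <= x a).
Hypotheses (xu : forall a, a \in P -> x u <= x a).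
Hypotheses (xw : forall a, a \notin P -> x a <= x w).
Hypotheses (xt : forall a, a \notin P -> a \notin [:: d; t1; t2] ->
  x t1 <= x a /\ x t2 <= x a).

Let symT : symmetric T. Proof. by apply: del_edge_sym; case: sg. Qed.
Let cP : c \in P. Proof. by case/and5P: ok. Qed.
Let uP : u \in P. Proof. by case/and5P: ok. Qed.
Let NP : [/\ d \notin P, w \notin P, t1 \notin P & t2 \notin P].
Proof. by case/and5P: ok => _ _ _ /and5P[]. Qed.
Let dP : d \notin P. Proof. by case: NP. Qed.
Let fg : f != g. Proof. by case: sg => _ iE; apply: contraTneq efg => ->; rewrite iE. Qed.

(** Outside [P] and apart from [d], the vertices [t1] and [t2] carry the two entries of largest
    absolute value. The cases arise because [f] or [g] may be one of them. *)
Lemma triangle_edge_bound : f \notin P -> g \notin P -> f != d -> g != d ->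
  x f * x g <= x t1 * x t2.
Proof.
move=> fP gP fd gd; case: NP => _ _ /xN x1 /xN x2; have x3 := xN fP; have x4 := xN gP.
have C a : a \notin P -> a != d -> [\/ a = t1, a = t2 | x t1 <= x a /\ x t2 <= x a].
  move=> aP ad; have := xt aP; rewrite !inE !negb_or ad /=.
  have [->|_] := eqVneq a t1; first by constructor 1.
  by have [->|_ H] := eqVneq a t2; [constructor 2|constructor 3; apply: H].
have nf : f <> g by apply/eqP.
case: (C f fP fd) => [E1|E1|[H1 H2]]; case: (C g gP gd) => [E2|E2|[H3 H4]];
  rewrite ?E1 ?E2 //; try (by rewrite E1 E2 in nf); rewrite ?E1 ?E2 in x3 x4 *;
  try exact: neg_mul_le; rewrite mulrC; try exact: neg_mul_le.
all: by rewrite [leRHS]mulrC; exact: neg_mul_le.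
Qed.

Lemma unicyclic_bound : qf e x <= phi P c u d w t1 t2 x.
Proof.
rewrite /qf /phi (sum_del_edge x sg efg) lerD2r (sum_split_sides P x symT).
have B1 := pos_side_bound symT conT bridgeT cP xP xc.
have B2 := neg_side_bound symT conT bridgeT dP xN xd.
have [a [b [aP bP Tab]]] := crossing_edge symT conT cP dP.
have B3 := cross_le_edge xP xN aP bP Tab.
have B4 : x a * x b <= x u * x w.
  by apply: opp_mul_le; rewrite ?xP ?xu ?xN ?xw.
(* If the deleted edge joins the two sides, its product is at most 0. *)
have B5 : x f * x g <= x t1 * x t2.
  case: fg_pos => [|[]]; last exact: triangle_edge_bound.
  have [_ _ t1P t2P] := NP.
  move=> fgP; apply: (@le_trans _ _ 0); last by rewrite mulr_le0 ?xN.
  move: fgP.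
  case fP: (f \in P); case gP: (g \in P) => // _.
    by rewrite mulr_ge0_le0 ?xP ?xN ?gP.
  by rewrite mulr_le0_ge0 ?xP ?xN ?fP.
rewrite /T in B1 B2 B3; lra.
Qed.

Section Equality.
Hypotheses (xPs : forall a, a \in P -> 0 < x a) (xNs : forall a, a \notin P -> x a < 0).
Hypotheses (xcs : forall a, a \in P -> a != c -> x a < x c).
Hypotheses (xds : forall a, a \notin P -> a != d -> x d < x a).
Hypotheses (xus : forall a, a \in P -> a != u -> x u < x a).
Hypotheses (xws : forall a, a \notin P -> a != w -> x a < x w).
Hypotheses (xts : forall a, a \notin P -> a \notin [:: d; t1; t2] ->
  x t1 < x a /\ x t2 < x a).

(** Each estimate behind [unicyclic_bound] must be an equality, and strictness of the extremal
    entries then identifies the edges one group at a time. *)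
Lemma unicyclic_bound_eq : qf e x = phi P c u d w t1 t2 x ->
  e =2 double_star P c u d w t1 t2.
Proof.
rewrite /qf /phi (sum_del_edge x sg efg) (sum_split_sides P x symT) => /addIr E.
have B1 := pos_side_bound symT conT bridgeT cP xP xc.
have B2 := neg_side_bound symT conT bridgeT dP xN xd.
have [a0 [b0 [aP bP Tab]]] := crossing_edge symT conT cP dP.
have B3 := cross_le_edge xP xN aP bP Tab.
have [_ wP t1P t2P] := NP.
have B4 a b : a \in P -> b \notin P -> x a * x b <= x u * x w.
  by move=> aP' bP'; apply: opp_mul_le; rewrite ?xP ?xu ?xN ?xw.
(* A deleted edge between the sides would contribute at most 0, strictly less than [x t1 * x t2]. *)
have fgN : [/\ f \notin P, g \notin P, f != d & g != d].
  case: fg_pos => // fgP; suff B5 : x f * x g <= 0.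
    have := B4 _ _ aP bP; have := nmulr_lgt0 (x t1) (xNs t2P); rewrite (xNs t1P).
    lra.
  move: fgP; case fP: (f \in P); case gP: (g \in P) => // _.
    by rewrite mulr_ge0_le0 ?xP ?xN ?gP.
  by rewrite mulr_le0_ge0 ?xP ?xN ?fP.
have B5 : x f * x g <= x t1 * x t2 by case: fgN; exact: triangle_edge_bound.
have E1 : x f * x g = x t1 * x t2.
  by have := B4 _ _ aP bP; lra.
(* Every crossing edge has to reach the product [x u * x w], which only the pair [u], [w]
   attains. *)
have cross a' b' : a' \in P -> b' \notin P -> T a' b' -> a' = u /\ b' = w.
  move=> aP' bP' Tab'; have B3' := cross_le_edge xP xN aP' bP' Tab'.
  have B6 : x a' * x b' = x u * x w.
    by have := B4 _ _ aP' bP'; lra.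
  split; apply/eqP; apply: contraT => ne.
    by have := opp_mul_ltl (xPs uP) (xus aP' ne) (xNs bP') (xw bP'); rewrite B6 ltxx.
  by have := opp_mul_ltr (xPs uP) (xu aP') (xNs bP') (xws bP' ne); rewrite B6 ltxx.
have [Ea Eb] := cross a0 b0 aP bP Tab; subst a0 b0.
have TP : forall a b, a \in P -> b \in P -> T a b = (a == c) (+) (b == c).
  apply: (side_bound_eq symT conT bridgeT xP cP xc xPs xcs).
  by have := B4 _ _ aP bP; lra.
have TN : forall a b, a \in ~: P -> b \in ~: P -> T a b = (a == d) (+) (b == d).
  have dN : d \in ~: P by rewrite inE.
  have xN' a : a \in ~: P -> 0 <= - x a by rewrite inE oppr_ge0; apply: xN.
  have xd' a : a \in ~: P -> - x a <= - x d by rewrite inE lerN2; apply: xd.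
  apply: (side_bound_eq symT conT bridgeT xN' dN xd').
  - by move=> a; rewrite inE oppr_gt0; apply: xNs.
  - by move=> a; rewrite inE ltrN2; apply: xds.
  by rewrite /= neg_sumE neg_starE; have := B4 _ _ aP bP; lra.
(* The entries at [t1] and [t2] may coincide, so the edge is determined only up to its
   orientation. *)
have fgt : (f = t1 /\ g = t2) \/ (f = t2 /\ g = t1).
  case: fgN => fP gP fd gd; have nf : f <> g by apply/eqP.
  have x1 := xNs t1P; have x2 := xNs t2P; have x3 := xNs fP; have x4 := xNs gP.
  have C a : a \notin P -> a != d -> [\/ a = t1, a = t2 | x t1 < x a /\ x t2 < x a].
    move=> aP' ad; have := xts aP'; rewrite !inE !negb_or ad /=.
    have [->|_] := eqVneq a t1; first by constructor 1.
    by have [->|_ H] := eqVneq a t2; [constructor 2|constructor 3; apply: H].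
  case: (C f fP fd) => [E1'|E1'|[H1 H2]]; case: (C g gP gd) => [E2|E2|[H3 H4]];
    rewrite ?E1' ?E2 in nf x3 x4 E1 *; try (by []); try (by left); try (by right);
    exfalso.
  - by have := neg_mul_lt (ltW x4) x1 H4 (lexx _); rewrite mulrC E1 mulrC ltxx.
  - by have := neg_mul_lt (ltW x4) x2 H3 (lexx _); rewrite mulrC E1 ltxx.
  - by have := neg_mul_lt (ltW x3) x1 H2 (lexx _); rewrite E1 mulrC ltxx.
  - by have := neg_mul_lt (ltW x3) x2 H1 (lexx _); rewrite E1 ltxx.
  by have := neg_mul_lt (ltW x3) x2 H1 (ltW H4); rewrite E1 ltxx.
have eE a b : e a b = T a b || ((a == t1) && (b == t2) || (a == t2) && (b == t1)).
  have -> : (a == t1) && (b == t2) || (a == t2) && (b == t1) =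
            (a == f) && (b == g) || (a == g) && (b == f).
    by case: fgt => -[-> ->] //; rewrite orbC.
  rewrite /T /del_edge; case E2: ((a == f) && _ || _); last by rewrite andbT orbF.
  rewrite orbT; case: sg => sE _.
  by case/orP: E2 => /andP[/eqP-> /eqP->]; rewrite // sE.
have Tc a b : a \in P -> b \notin P -> T a b = (a == u) && (b == w).
  move=> aP' bP'; apply/idP/andP => [/(cross _ _ aP' bP')[-> ->] //|[/eqP-> /eqP->] //].
move=> a b; rewrite eE /double_star /double_star_dir.
have -> : T a b = if a \in P
    then if b \in P then (a == c) (+) (b == c) else (a == u) && (b == w)
    else if b \in P then (b == u) && (a == w) else (a == d) (+) (b == d).
  case aP': (a \in P); case bP': (b \in P); first exact: TP.
  - by rewrite Tc ?bP'.
  - by rewrite symT Tc ?aP'.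
  by rewrite TN // inE ?aP' ?bP'.
by case: (double_starP a ok) => [_|_||_|_|_|_|]; case: (double_starP b ok).
Qed.
End Equality.
End UnicyclicBound.

(** * Completing squares *)

(* Testing with a multiplier [l] instead of applying Cauchy-Schwarz avoids a
   special case for stars without leaves. *)
Lemma residual_energy (R : realFieldType) (mu kP kN rP rN VP VN ru rw r1 r2 l : R) :
  1 < mu ->
  (forall r, 2 * r * rP - r ^+ 2 * kP <= VP) ->
  (forall r, 2 * r * rN - r ^+ 2 * kN <= VN) ->
  2 * l * (rP + rN + ru + rw + r1 + r2) -
    l ^+ 2 * ((kP + kN) / mu + 4 / (mu - 1)) <=
  mu * VP + mu * VN + mu * (ru ^+ 2 + rw ^+ 2) - 2 * (ru * rw) +
  mu * (r1 ^+ 2 + r2 ^+ 2) - 2 * (r1 * r2).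
Proof.
move=> mu1 hP hN; have mp : 0 < mu by rewrite (lt_trans ltr01).
have mp1 : 0 < mu - 1 by rewrite subr_gt0.
have m0 := lt0r_neq0 mp; have m1 := lt0r_neq0 mp1.
(* The variance hypotheses are used at [l / mu] because the variances enter with the factor [mu]. *)
have {}hP : 2 * l * rP - l ^+ 2 * (kP / mu) <= mu * VP.
  have := ler_wpM2l (ltW mp) (hP (l / mu)); apply: le_trans; rewrite le_eqVlt.
  by apply/orP; left; apply/eqP; field.
have {}hN : 2 * l * rN - l ^+ 2 * (kN / mu) <= mu * VN.
  have := ler_wpM2l (ltW mp) (hN (l / mu)); apply: le_trans; rewrite le_eqVlt.
  by apply/orP; left; apply/eqP; field.
(* The smallest eigenvalue [mu - 1] of this form belongs to the direction (1, 1), whence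
   [2 / (mu - 1)] for each of the two adjacent pairs. *)
have H a b : 2 * l * (a + b) - l ^+ 2 * (2 / (mu - 1)) <=
    mu * (a ^+ 2 + b ^+ 2) - 2 * (a * b).
  rewrite -subr_ge0 (_ : _ - _ = (mu - 1) * ((a - l / (mu - 1)) ^+ 2 + (b - l / (mu - 1)) ^+ 2)
     + (a - b) ^+ 2); last by field.
  exact: addr_ge0 (mulr_ge0 (ltW mp1) (addr_ge0 (sqr_ge0 _) (sqr_ge0 _))) (sqr_ge0 _).
have := H ru rw; have := H r1 r2; move: hP hN {H}.
move: (mu^-1) ((mu - 1)^-1) => i j; lra.
Qed.

Section Reduction.
Variable R : realFieldType.
Variables mu kP kN : R.

(* Write C, D for the entries at the two centers minus the sum s of all entries.
   The eigenvalue equations at the other vertices express every entry through C,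
   D and s; [sigma] and [delta] are then the sum and the difference of the
   diagonal coefficients of the remaining form in (C, D), each of them shifted
   by 1 / (mu^2 - 1). *)
Definition sigma : R := 2 * mu - (kP + kN) / mu - 2 / (mu - 1) - 2 / (mu + 1).
Definition delta : R := (kN - kP) / mu + 2 / (mu - 1).
Definition wgt : R := 1 + (kP + kN) / mu + 4 / (mu - 1).
(** The minimum of [sigma + (2 * mu + 3) * v ^+ 2 + wgt * k ^+ 2] under the constraint
    [v + wgt * k = delta], as given by Cauchy-Schwarz. *)
Definition threshold : R :=
  sigma + delta ^+ 2 * (2 * mu + 3) / (1 + wgt * (2 * mu + 3)).

Hypotheses (mu1 : 1 < mu) (kP0 : 0 <= kP) (kN0 : 0 <= kN).

(** [kP] and [kN] stand for the numbers of leaves at the two centers, [Y] and [Z] for the sums of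
    the leaf entries, [EP] and [EN] for the sums of their squares. [W] is [mu] times the squared
    norm minus the form [phi]. *)
Variables c u d w t1 t2 Y Z EP EN : R.

Let s := c + u + Y + (d + w + t1 + t2 + Z).
Let C := c - s.
Let D := d - s.
Let m := (C - D) / 2.
Let k := (C + D) / 2.
Let ru := u - (mu * C + D) / (mu ^+ 2 - 1).
Let rw := w - (C + mu * D) / (mu ^+ 2 - 1).
Let r1 := t1 - D / (mu - 1).
Let r2 := t2 - D / (mu - 1).
Let rP := Y - kP * C / mu.
Let rN := Z - kN * D / mu.
Let rho := rP + rN + ru + rw + r1 + r2.
Let VP := EP - 2 * (C / mu) * Y + kP * (C / mu) ^+ 2.
Let VN := EN - 2 * (D / mu) * Z + kN * (D / mu) ^+ 2.
Let W := mu * (c ^+ 2 + u ^+ 2 + EP + (d ^+ 2 + w ^+ 2 + t1 ^+ 2 + t2 ^+ 2 + EN)) -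
  (2 * (c * (u + Y)) + 2 * (d * (w + t1 + t2 + Z)) + 2 * (t1 * t2) + 2 * (u * w) - s ^+ 2).

Let mu_n0 : mu != 0. Proof. by rewrite gt_eqF // (lt_trans ltr01). Qed.
Let mu_n1 : mu - 1 != 0. Proof. by rewrite subr_eq0 gt_eqF. Qed.
Let mu_n2 : mu + 1 != 0. Proof. by rewrite gt_eqF // addr_gt0 // (lt_trans ltr01). Qed.
Let mu_n3 : mu ^+ 2 - 1 != 0.
Proof. by rewrite (_ : _ - 1 = (mu - 1) * (mu + 1)); [rewrite mulf_neq0|ring]. Qed.

(* [ru], [rw], [r1], [r2], [rP], [rN] are the residuals of the eigenvalue
   equations away from the centers; VP and VN are the variances of the leaf
   entries around the values prescribed by these equations. *)
Lemma reduction_constraint : (s + k) + (wgt * k + rho) = delta * m.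
Proof.
rewrite /rho /m /k /ru /rw /r1 /r2 /rP /rN /wgt /delta /C /D /s.
field; do ?[apply/andP; split] => //.
Qed.

(** Completing squares at all noncentral entries leaves [k * rho] as the only product of a residual
    with the central variables. *)
Lemma reduction_identity : W = sigma * m ^+ 2 + (2 * mu + 3) * (s + k) ^+ 2 +
  wgt * k ^+ 2 + 2 * k * rho + (mu * VP + mu * VN + mu * (ru ^+ 2 + rw ^+ 2) -
  2 * (ru * rw) + mu * (r1 ^+ 2 + r2 ^+ 2) - 2 * (r1 * r2)).
Proof.
rewrite /W /VP /VN /rho /m /k /ru /rw /r1 /r2 /rP /rN /wgt /sigma /C /D /s.
field; do ?[apply/andP; split] => //.
Qed.

Lemma wgt_gt1 : 1 < wgt.
Proof.
rewrite /wgt -addrA ltrDl; apply: ltr_wpDl; first by rewrite divr_ge0 ?addr_ge0 // ltW // (lt_trans ltr01).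
by rewrite divr_gt0 ?ltr0n // subr_gt0.
Qed.

Lemma reduction_bound : (forall r, 2 * r * rP - r ^+ 2 * kP <= VP) ->
  (forall r, 2 * r * rN - r ^+ 2 * kN <= VN) -> threshold * m ^+ 2 <= W.
Proof.
move=> hP hN; rewrite reduction_identity.
have w1 := wgt_gt1;
(* This multiplier maximizes the bound, which becomes [rho ^+ 2 / (wgt - 1)]. *)
have := residual_energy ru rw r1 r2 (rho / (wgt - 1)) mu1 hP hN.
rewrite (_ : (kP + kN) / mu + _ = wgt - 1); last by rewrite /wgt; ring.
rewrite -/rho.
have := reduction_constraint; move: (s + k) => v E H.
apply: le_trans (lerD (lexx _) H).
have A0 : 0 < 2 * mu + 3 by rewrite addr_gt0 ?mulr_gt0 ?ltr0n // (lt_trans ltr01).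
have w0 : 0 < wgt by rewrite (lt_trans ltr01).
have w10 : 0 < wgt - 1 by rewrite subr_gt0.
have B0 : 0 < 1 + wgt * (2 * mu + 3) by rewrite addr_gt0 // mulr_gt0.
rewrite -subr_ge0 /threshold.
(* The first square is the Cauchy-Schwarz defect of the constraint; the second is what remains of
   [rho] after completing the square in [k]. *)
rewrite (_ : _ - _ =
   ((2 * mu + 3) * wgt * v - (wgt * k + rho)) ^+ 2 / (wgt * (1 + wgt * (2 * mu + 3))) +
   rho ^+ 2 / (wgt * (wgt - 1))).
  by rewrite addr_ge0 // divr_ge0 ?sqr_ge0 // mulr_ge0 // ltW.
have T : delta ^+ 2 * (2 * mu + 3) / (1 + wgt * (2 * mu + 3)) * m ^+ 2 =
    (v + (wgt * k + rho)) ^+ 2 * (2 * mu + 3) / (1 + wgt * (2 * mu + 3)).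
  by rewrite E; ring.
rewrite [(sigma + _) * _]mulrDl T; move: (sigma) (wgt) w0 w10 B0 (k) (m) (rho) => sg h w0 w10 B0 k' m' rho'.
by field; rewrite !gt_eqF.
Qed.

End Reduction.

Section ReductionAttained.
Variable R : realFieldType.
Variables mu kP kN : R.
Hypotheses (mu1 : 1 < mu) (kP0 : 0 <= kP) (kN0 : 0 <= kN).

(** In the extremal vector all residuals vanish, [m = 1], and the constrained minimum in [threshold]
    is attained. *)
Lemma reduction_attained : exists c u d w t y z : R,
  let s := c + u + kP * y + (d + w + t + t + kN * z) in
  mu * (c ^+ 2 + u ^+ 2 + kP * y ^+ 2 +
        (d ^+ 2 + w ^+ 2 + t ^+ 2 + t ^+ 2 + kN * z ^+ 2)) -
  (2 * (c * (u + kP * y)) + 2 * (d * (w + t + t + kN * z)) + 2 * (t * t) +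
   2 * (u * w) - s ^+ 2) = threshold mu kP kN.
Proof.
have m1 : mu - 1 != 0 by rewrite subr_eq0 gt_eqF.
have m0 : mu != 0 by rewrite gt_eqF // (lt_trans ltr01).
have m2 : mu + 1 != 0 by rewrite gt_eqF // addr_gt0 // (lt_trans ltr01).
have m3 : mu ^+ 2 - 1 != 0.
  by rewrite (_ : _ - 1 = (mu - 1) * (mu + 1)); [rewrite mulf_neq0|ring].
have w1 := wgt_gt1 mu1 kP0 kN0.
have A0 : 0 < 2 * mu + 3 by rewrite addr_gt0 ?mulr_gt0 ?ltr0n // (lt_trans ltr01).
have B0 : 0 < 1 + wgt mu kP kN * (2 * mu + 3).
  by rewrite addr_gt0 // mulr_gt0 // (lt_trans ltr01).
pose v := delta mu kP kN / (1 + wgt mu kP kN * (2 * mu + 3)).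
pose k := (2 * mu + 3) * v.
pose s := v - k; pose C := 1 + k; pose D := k - 1.
exists (C + s), ((mu * C + D) / (mu ^+ 2 - 1)), (D + s),
  ((C + mu * D) / (mu ^+ 2 - 1)), (D / (mu - 1)), (C / mu), (D / mu).
move=> s'.
(* The entries were written down in terms of a prescribed total [s]; this checks that they really
   add up to it. *)
have Es : s' = s.
  have E : s + k * (wgt mu kP kN + 1) = delta mu kP kN.
    by rewrite /s /k /v; field; rewrite gt_eqF.
  apply/eqP; rewrite -subr_eq0; apply/eqP.
  transitivity (s + k * (wgt mu kP kN + 1) - delta mu kP kN); last by rewrite E subrr.
  rewrite /s' /C /D /wgt /delta {E s'}; clearbody s; clearbody k.
  by field; do ?[apply/andP; split].
have := @reduction_identity R mu kP kN mu1 (C + s) ((mu * C + D) / (mu ^+ 2 - 1)) (D + s)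
  ((C + mu * D) / (mu ^+ 2 - 1)) (D / (mu - 1)) (D / (mu - 1)) (kP * (C / mu)) (kN * (D / mu))
  (kP * (C / mu) ^+ 2) (kN * (D / mu) ^+ 2).
rewrite -/s' Es => ->; rewrite !addrK /C /D.
rewrite /threshold /s /k /v; move: (sigma _ _ _) => sg; move: (wgt _ _ _) (delta _ _ _) B0 => h e B0.
field; do ?[apply/andP; split] => //; by rewrite gt_eqF.
Qed.
End ReductionAttained.

(** * Comparing double stars *)

Section DoubleStarForm.
Variables (R : realFieldType) (n : nat).
Variables (P : {set 'I_n}) (c u d w t1 t2 : 'I_n).
Hypothesis ok : double_star_ok P c u d w t1 t2.

Definition leaf1 := [set i in P | (i != c) && (i != u)].
Definition leaf2 := [set i in ~: P | [&& i != d, i != w, i != t1 & i != t2]].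

Lemma sum_side1 (F : 'I_n -> R) :
  \sum_(i in P | i != c) F i = F u + \sum_(i in leaf1) F i.
Proof.
rewrite (bigD1 u) /=; last by case/and5P: ok => _ -> ->.
by congr (_ + _); apply: eq_bigl => i; rewrite !inE andbA.
Qed.

Lemma sum_side2 (F : 'I_n -> R) :
  \sum_(i in ~: P | i != d) F i = F w + F t1 + F t2 + \sum_(i in leaf2) F i.
Proof.
rewrite (bigD1 w) /=; last by rewrite inE; case: (double_starP w ok) (eqxx w).
rewrite (bigD1 t1) /=; last by rewrite inE; case: (double_starP t1 ok) (eqxx t1).
rewrite (bigD1 t2) /=; last by rewrite inE; case: (double_starP t2 ok) (eqxx t2).
by rewrite !addrA; congr (_ + _); apply: eq_bigl => i; rewrite !inE -!andbA.
Qed.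

Lemma sum_double_star (F : 'I_n -> R) : \sum_i F i =
  F c + F u + \sum_(i in leaf1) F i +
  (F d + F w + F t1 + F t2 + \sum_(i in leaf2) F i).
Proof.
rewrite (bigID (mem P)) /= (bigD1 c) /=; last by case/and5P: ok.
rewrite sum_side1 (bigD1 d (P := fun i => i \notin P)) /=; last first.
  by case: (double_starP d ok) (eqxx d).
have -> : \sum_(i | (i \notin P) && (i != d)) F i = \sum_(i in ~: P | i != d) F i.
  by apply: eq_bigl => i; rewrite inE.
by rewrite sum_side2 !addrA.
Qed.

Lemma card_leaf1 : (#|leaf1| + 2 = #|P|)%N.
Proof.
case/and5P: ok => cP uP uc _ _.
rewrite (cardsD1 c P) (cardsD1 u (P :\ c)) !inE cP uP uc addnC.
congr (_.+2); by apply: eq_card => i; rewrite !inE; case: (i == u); case: (i == c); rewrite ?andbF ?andbT.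
Qed.

Lemma card_leaf2 : (#|leaf2| + 4 = #|~: P|)%N.
Proof.
rewrite (cardsD1 d (~: P)) (cardsD1 w (_ :\ d)) (cardsD1 t1 (_ :\ w)) (cardsD1 t2 (_ :\ t1)).
have -> : d \in ~: P by rewrite inE; case: (double_starP d ok) (eqxx d).
have -> : w \in ~: P :\ d by rewrite !inE; case: (double_starP w ok) (eqxx w).
have -> : t1 \in ~: P :\ d :\ w by rewrite !inE; case: (double_starP t1 ok) (eqxx t1).
have -> : t2 \in ~: P :\ d :\ w :\ t1.
  by rewrite !inE; case: (double_starP t2 ok) (eqxx t2).
rewrite addnC; congr (_.+4); apply: eq_card => i; rewrite !inE.
by case: (i \in P); case: (i == d); case: (i == w); case: (i == t1); case: (i == t2).
Qed.

(** This expands the nonnegative sum of the squares of [x i - (a + r)]. The free parameter [r]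
    stands in for Cauchy-Schwarz and allows [A] to be empty. *)
Lemma variance_bound (I : finType) (A : {set I}) (x : I -> R) (a r : R) :
  2 * r * (\sum_(i in A) x i - #|A|%:R * a) - r ^+ 2 * #|A|%:R <=
  \sum_(i in A) x i ^+ 2 - 2 * a * \sum_(i in A) x i + #|A|%:R * a ^+ 2.
Proof.
have : 0 <= \sum_(i in A) (x i - (a + r)) ^+ 2 by apply: sumr_ge0 => i _; exact: sqr_ge0.
have -> : \sum_(i in A) (x i - (a + r)) ^+ 2 = \sum_(i in A) x i ^+ 2 -
    2 * (a + r) * \sum_(i in A) x i + #|A|%:R * (a + r) ^+ 2.
  rewrite (mulr_natl _ #|A|) -sumr_const big_distrr /= -sumrB -big_split /=.
  by apply: eq_bigr => i _; ring.
move: (\sum_(i in A) x i ^+ 2) (\sum_(i in A) x i) (#|A|%:R) => S2 S1 k; lra.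
Qed.

Lemma phi_bound (mu : R) (x : 'I_n -> R) : 1 < mu ->
  threshold mu #|leaf1|%:R #|leaf2|%:R * ((x c - x d) / 2) ^+ 2 <=
  mu * sqnorm x - phi P c u d w t1 t2 x.
Proof.
move=> mu1; rewrite /sqnorm /phi sum_side1 sum_side2 !sum_double_star.
set s := x c + _ + _ + _.
have vP r := variance_bound leaf1 x ((x c - s) / mu) r.
have vN r := variance_bound leaf2 x ((x d - s) / mu) r.
have := @reduction_bound R mu _ _ mu1 (ler0n _ #|leaf1|) (ler0n _ #|leaf2|)
  (x c) (x u) (x d) (x w) (x t1) (x t2) (\sum_(i in leaf1) x i)
  (\sum_(i in leaf2) x i) (\sum_(i in leaf1) x i ^+ 2) (\sum_(i in leaf2) x i ^+ 2).
rewrite -/s (_ : x c - s - (x d - s) = x c - x d); last by ring.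
by apply=> r; [have := vP r|have := vN r]; rewrite !mulrA.
Qed.

Section StarVector.
Variables (vc vu vd vw vt vy vz : R).

Let star_vector (i : 'I_n) : R :=
  if i == c then vc else if i == u then vu else if i == d then vd else
  if i == w then vw else if (i == t1) || (i == t2) then vt else
  if i \in P then vy else vz.

Lemma star_vector_form : exists x : 'I_n -> R,
  let s := vc + vu + #|leaf1|%:R * vy +
    (vd + vw + vt + vt + #|leaf2|%:R * vz) in
  sqnorm x = vc ^+ 2 + vu ^+ 2 + #|leaf1|%:R * vy ^+ 2 +
    (vd ^+ 2 + vw ^+ 2 + vt ^+ 2 + vt ^+ 2 + #|leaf2|%:R * vz ^+ 2) /\
  phi P c u d w t1 t2 x = 2 * (vc * (vu + #|leaf1|%:R * vy)) +
    2 * (vd * (vw + vt + vt + #|leaf2|%:R * vz)) + 2 * (vt * vt) + 2 * (vu * vw) - s ^+ 2.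
Proof.
exists star_vector => s.
have Ec : star_vector c = vc by rewrite /star_vector eqxx.
have Eu : star_vector u = vu.
  by rewrite /star_vector; case: (double_starP u ok) (eqxx u).
have Ed : star_vector d = vd.
  by rewrite /star_vector; case: (double_starP d ok) (eqxx d).
have Ew : star_vector w = vw.
  by rewrite /star_vector; case: (double_starP w ok) (eqxx w).
have Et1 : star_vector t1 = vt.
  by rewrite /star_vector; case: (double_starP t1 ok) (eqxx t1).
have Et2 : star_vector t2 = vt.
  by rewrite /star_vector; case: (double_starP t2 ok) (eqxx t2).
have S1 (F : R -> R) : \sum_(i in leaf1) F (star_vector i) = #|leaf1|%:R * F vy.
  rewrite mulr_natl -sumr_const; apply: eq_bigr => i; rewrite inE /star_vector.
  by case: (double_starP i ok).
have S2 (F : R -> R) : \sum_(i in leaf2) F (star_vector i) = #|leaf2|%:R * F vz.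
  rewrite mulr_natl -sumr_const; apply: eq_bigr => i; rewrite !inE /star_vector.
  by case: (double_starP i ok).
rewrite /sqnorm /phi sum_side1 sum_side2 !sum_double_star.
by rewrite (S1 id) (S2 id) (S1 (fun v => v ^+ 2)) (S2 (fun v => v ^+ 2)) Ec Eu Ed Ew Et1 Et2.
Qed.
End StarVector.

Lemma phi_attained (mu : R) : 1 < mu -> exists x : 'I_n -> R,
  mu * sqnorm x - phi P c u d w t1 t2 x = threshold mu #|leaf1|%:R #|leaf2|%:R.
Proof.
move=> mu1.
have [vc [vu [vd [vw [vt [vy [vz E]]]]]]] :=
  reduction_attained mu1 (ler0n _ #|leaf1|) (ler0n _ #|leaf2|).
by have [x [E1 E2]] := star_vector_form vc vu vd vw vt vy vz; exists x; rewrite E1 E2.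
Qed.

(* For 8 leaves at the first center and 6 at the second, the vector with entries
   3, 1 on the first star and -3, -1 on the second gives exactly 3; moving the
   ends of the joining edge to 3/4 and -3/4 makes the inequality strict. *)
Lemma phi_gt3 : (8 <= #|leaf1|)%N -> (6 <= #|leaf2|)%N ->
  exists x : 'I_n -> R, 3 * sqnorm x < phi P c u d w t1 t2 x.
Proof.
(* Additional leaves share the same leaf sums 8 and -6: the total of all entries stays 0, the form
   is unchanged, and the norm can only decrease. *)
move=> l1 l2; have := star_vector_form 3 (3 / 4) (-3) (- (3 / 4)) (-1)
  (8 / #|leaf1|%:R) (- 6 / #|leaf2|%:R).
case=> x [E1 E2]; exists x; rewrite E1 E2 {E1 E2 x}.
have {l1} : 8 <= #|leaf1|%:R :> R by rewrite (ler_nat R 8).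
have {l2} : 6 <= #|leaf2|%:R :> R by rewrite (ler_nat R 6).
move: (#|leaf1|%:R) (#|leaf2|%:R) => p q q6 p8.
have p0 : p != 0 by rewrite gt_eqF // (lt_le_trans _ p8) ?ltr0n.
have q0 : q != 0 by rewrite gt_eqF // (lt_le_trans _ q6) ?ltr0n.
have H1 : p * (8 / p) ^+ 2 <= 8.
  have -> : p * (8 / p) ^+ 2 = 8 * (8 / p) by field.
  by rewrite ler_piMr ?ler0n // ler_pdivrMr ?mul1r // (lt_le_trans _ p8) ?ltr0n.
have H2 : q * (- 6 / q) ^+ 2 <= 6.
  have -> : q * (- 6 / q) ^+ 2 = 6 * (6 / q) by field.
  by rewrite ler_piMr ?ler0n // ler_pdivrMr ?mul1r // (lt_le_trans _ q6) ?ltr0n.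
have E1 : p * (8 / p) = 8 by field.
have E2 : q * (- 6 / q) = - 6 by field.
rewrite E1 E2; move: (p * _) (q * _) H1 H2 => a b *; lra.
Qed.

End DoubleStarForm.

(** For a fixed order only [delta ^+ 2] varies. Up to the factor [mu], [delta] is the difference of
    the two side sizes plus [th], with [th] strictly between 0 and 1. This is below 1 in absolute
    value for the differences 0 and -1 and above 1 for all others of the same parity. *)
Lemma threshold_lt (R : realFieldType) (mu : R) (a b a' b' : nat) :
  3 < mu -> (a + 2 + (b + 4) = a' + 2 + (b' + 4))%N ->
  (a' + 2 = b' + 4 \/ a' + 2 = b' + 5)%N -> a != a' ->
  threshold mu a'%:R b'%:R < threshold mu a%:R b%:R.
Proof.
move=> mu3 Eab; have m0 : 0 < mu by rewrite (lt_trans _ mu3) ?ltr0n.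
have m1 : 0 < mu - 1 by rewrite subr_gt0 (lt_trans _ mu3) ?(ltr_nat R 1 3).
have E : a%:R + b%:R = a'%:R + b'%:R :> R by rewrite -!natrD; congr _%:R; lia.
have mu1 : 1 < mu by rewrite (lt_trans _ mu3) ?(ltr_nat R 1 3).
have w1 := wgt_gt1 mu1 (ler0n _ a') (ler0n _ b').
have EW : wgt mu a%:R b%:R = wgt mu a'%:R b'%:R by rewrite /wgt E.
have ES : sigma mu a%:R b%:R = sigma mu a'%:R b'%:R by rewrite /sigma E.
have A0 : 0 < 2 * mu + 3 by lra.
move=> h ne; rewrite /threshold ES EW ltrD2l ltr_pM2r; last first.
  by rewrite invr_gt0 addr_gt0 // mulr_gt0 // (lt_trans ltr01).
rewrite ltr_pM2r //.
pose th := 2 / (mu - 1).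
have th0 : 0 < th by rewrite divr_gt0 ?ltr0n.
have th1 : th < 1 by rewrite ltr_pdivrMr // mul1r; lra.
have D k l : delta mu k l = (l - k + 2 + th) / mu.
  by rewrite /delta /th; field; rewrite !gt_eqF.
rewrite !D !exprMn ltr_pM2r ?exprn_gt0 ?invr_gt0 //.
have Db : b%:R = a'%:R + b'%:R - a%:R :> R by rewrite -E; ring.
have [j Ej jr] : exists2 j : R, b'%:R - a'%:R + 2 = j & j = 0 \/ j = -1.
  case: h => h; [exists 0|exists (-1)]; try (by [left|right]).
    have -> : a' = b'.+2 by lia.
    by rewrite -addn2 natrD; ring.
  have -> : a' = b'.+3 by lia.
  by rewrite -addn3 natrD; ring.
have [r Er rr] : exists2 r : R, a%:R = a'%:R + r & 1 <= r \/ r <= -1.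
  exists (a%:R - a'%:R); first by ring.
  have [l|l|l] := ltngtP a a'; last by rewrite l eqxx in ne.
    by right; rewrite -(ler_nat R) -natr1 in l; lra.
  by left; rewrite -(ler_nat R) -natr1 in l; lra.
rewrite Ej Db Er (_ : _ + _ - _ - _ + 2 = j - 2 * r); last by rewrite -Ej; ring.
case: jr => ->; case: rr => rr; nra.
Qed.

(** * Isomorphisms of double stars *)

Section Isomorphism.
Variable n : nat.

Lemma map_bijection (s1 s2 : seq 'I_n) : uniq s1 -> uniq s2 ->
  size s1 = n -> size s2 = n -> exists f : 'I_n -> 'I_n, bijective f /\ map f s1 = s2.
Proof.
move=> u1 u2 z1 z2.
have m1 i : i \in s1.
  have sub : {subset s1 <= enum 'I_n} by move=> x _; rewrite mem_enum.
  by have [|_ ->] := uniq_min_size u1 sub; rewrite ?mem_enum // z1 size_enum_ord.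
pose f i := nth i s2 (index i s1); exists f.
have Em : map f s1 = s2.
  case: s1 u1 z1 m1 @f => [|x0 s1] u1 z1 m1 f.
    by rewrite (@size0nil _ s2) //; exact: etrans z2 (esym z1).
  apply: (@eq_from_nth _ x0); rewrite size_map z1 // => i il.
  rewrite (nth_map x0) ?z1 // /f index_uniq ?z1 //; apply: set_nth_default.
  by rewrite z2.
split=> //; apply: injF_bij => i j.
have il k : (index k s1 < size s2)%N by rewrite z2 -[X in (_ < X)%N]z1 index_mem.
rewrite /f (set_nth_default i j) // => /eqP; rewrite nth_uniq // => /eqP E.
by rewrite -(nth_index i (m1 i)) E nth_index.
Qed.

(** The vertices are listed by role, so that matching two listings position by position respects
    adjacency once the leaf counts agree. *)
Definition star_listing (P : {set 'I_n}) c u d w t1 t2 :=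
  [:: c, u & enum (leaf1 P c u)] ++ [:: d, w, t1, t2 & enum (leaf2 P d w t1 t2)].

Lemma star_listing_uniq P c u d w t1 t2 : double_star_ok P c u d w t1 t2 ->
  uniq (star_listing P c u d w t1 t2) /\ size (star_listing P c u d w t1 t2) = n.
Proof.
move=> ok; set s := star_listing _ _ _ _ _ _ _.
have zs : size s = n.
  rewrite /s /star_listing size_cat /= -!cardE.
  have := card_leaf1 ok; have := card_leaf2 ok; have := cardsC P; rewrite card_ord.
  by move=> H H2 H1; rewrite -[RHS]H -H2 -H1 addn2 addn4.
split=> //; apply: (leq_size_uniq (enum_uniq 'I_n)); last by rewrite zs size_enum_ord.
move=> a _; rewrite /s /star_listing mem_cat !inE !mem_enum !inE.
by case: (double_starP a ok).
Qed.

Lemma double_star_iso P c u d w t1 t2 P' c' u' d' w' t1' t2' :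
  double_star_ok P c u d w t1 t2 -> double_star_ok P' c' u' d' w' t1' t2' ->
  #|P| = #|P'| ->
  @gisomorphic n (double_star P c u d w t1 t2) (double_star P' c' u' d' w' t1' t2').
Proof.
move=> ok ok' cPP.
have [u1 z1] := star_listing_uniq ok; have [u2 z2] := star_listing_uniq ok'.
have [f [bf]] := map_bijection u1 u2 z1 z2.
have injf := bij_inj bf.
have c1 := card_leaf1 ok; have c1' := card_leaf1 ok'.
move=> /eqP; rewrite /star_listing map_cat eqseq_cat; last first.
  rewrite size_map /= -!cardE; congr _.+2; apply/eqP.
  by rewrite -(eqn_add2r 2) c1 c1' cPP.
rewrite /= => /andP[/eqP[fc fu f1] /eqP[fd fw ft1 ft2 f2]].
have fP a : (f a \in P') = (a \in P).
  have l1 : a \in leaf1 P c u -> f a \in leaf1 P' c' u'.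
    by move=> al; rewrite -mem_enum -f1; apply: map_f; rewrite mem_enum.
  have l2 : a \in leaf2 P d w t1 t2 -> f a \in leaf2 P' d' w' t1' t2'.
    by move=> al; rewrite -mem_enum -f2; apply: map_f; rewrite mem_enum.
  move: l1 l2; rewrite !inE.
  case/and5P: ok' => /= cP uP _ /and5P[/= /negbTE dP /negbTE wP /negbTE t1P /negbTE t2P _] _.
  case: (double_starP a ok) => [->|->||->|->|->|->|];
    rewrite ?fc ?fu ?fd ?fw ?ft1 ?ft2 //=; first by move=> /(_ isT)/andP[].
  by move=> _ /(_ isT)/andP[/negbTE].
exists f; split=> // a b; rewrite /double_star /double_star_dir !fP.
by rewrite -{1 2 3 4}fc -{1 2}fu -{1 2 3 4}fd -{1 2}fw -{1 2}ft1 -{1 2}ft2 !(inj_eq injf).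
Qed.
End Isomorphism.

(** * Null vectors *)

(** Since [wgt > 1], a nonnegative threshold gives [sigma >= - delta ^+ 2], so the last two squares
    together are at most [m ^+ 2 / 9]. Their weights exceed 1 and, as [mu > 3], 9. *)
Lemma null_vector_bounds (R : realFieldType) (mu kP kN m k v : R) :
  3 < mu -> 0 <= kP -> 0 <= kN -> 0 <= threshold mu kP kN ->
  9 * delta mu kP kN ^+ 2 <= 1 ->
  sigma mu kP kN * m ^+ 2 + (2 * mu + 3) * v ^+ 2 + wgt mu kP kN * k ^+ 2 = 0 ->
  9 * k ^+ 2 <= m ^+ 2 /\ 81 * v ^+ 2 <= m ^+ 2.
Proof.
move=> mu3 kP0 kN0; have mu1 : 1 < mu by lra.
have w1 := wgt_gt1 mu1 kP0 kN0; rewrite /threshold.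
move: (wgt _ _ _) (delta _ _ _ ^+ 2) (sqr_ge0 (delta mu kP kN)) w1 => h d2 d0 w1.
have -> : d2 * (2 * mu + 3) / (1 + h * (2 * mu + 3)) = d2 / ((2 * mu + 3)^-1 + h).
  by field; rewrite !gt_eqF //; nra.
have A0 : 0 < (2 * mu + 3)^-1 by rewrite invr_gt0; lra.
have H : d2 / ((2 * mu + 3)^-1 + h) <= d2.
  by rewrite ler_pdivrMr; [rewrite ler_peMr //|]; lra.
move: (_ / (_ + h)) H (sigma _ _ _) => r H sg T D E.
have m0 := sqr_ge0 m; have k0 := sqr_ge0 k; have v0 := sqr_ge0 v.
have S : (2 * mu + 3) * v ^+ 2 + h * k ^+ 2 <= d2 * m ^+ 2.
  have : 0 <= (sg + d2) * m ^+ 2 by rewrite mulr_ge0 //; lra.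
  by rewrite mulrDl; lra.
have D9 : 9 * (d2 * m ^+ 2) <= m ^+ 2.
  by rewrite mulrA ler_piMl.
have Q1 : k ^+ 2 <= h * k ^+ 2 by rewrite ler_peMl // ltW.
have Q2 : 9 * v ^+ 2 <= (2 * mu + 3) * v ^+ 2 by rewrite ler_wpM2r //; lra.
split; lra.
Qed.

Lemma sqr_bound (R : realFieldType) (a b m k : R) : b = a ^+ 2 -> 0 < a -> 0 <= m ->
  b * k ^+ 2 <= m ^+ 2 -> - m <= a * k <= m.
Proof.
move=> -> a0 m0; rewrite -exprMn; move: (a * k) => z zm.
by apply/andP; split; rewrite leNgt; apply/negP => h; nra.
Qed.

(** The hypotheses place [C] and [- D] between 2/3 and 4/3 of [m] and bound [s + k] by [m / 9] in
    absolute value. For [mu > 3] this separates the values that the eigenvalue equations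
    prescribe. *)
Lemma star_profile (R : realFieldType) (mu C D s : R) :
  3 < mu -> 0 < C - D ->
  9 * ((C + D) / 2) ^+ 2 <= ((C - D) / 2) ^+ 2 ->
  81 * (s + (C + D) / 2) ^+ 2 <= ((C - D) / 2) ^+ 2 ->
  [/\ 0 < (mu * C + D) / (mu ^+ 2 - 1),
      (mu * C + D) / (mu ^+ 2 - 1) < C / mu & C / mu < C + s] /\
  [/\ D + s < D / (mu - 1), D / (mu - 1) < D / mu,
      D / mu < (C + mu * D) / (mu ^+ 2 - 1) &
      (C + mu * D) / (mu ^+ 2 - 1) < 0].
Proof.
move=> mu3; set m := (C - D) / 2; set k := (C + D) / 2; move=> CD.
have m0 : 0 < m by rewrite divr_gt0 ?ltr0n.
have EC : C = m + k by rewrite /m /k; field.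
have ED : D = k - m by rewrite /m /k; field.
have e9 : 9 = 3 ^+ 2 :> R by ring.
have e81 : 81 = 9 ^+ 2 :> R by ring.
move=> /(sqr_bound e9 (ltr0n _ 3) (ltW m0)) /andP[k1 k2].
move=> /(sqr_bound e81 (ltr0n _ 9) (ltW m0)) /andP[v1 v2].
rewrite EC ED; clearbody m k; clear EC ED CD C D e9 e81.
have mu0 : 0 < mu by lra.
have mu1 : 0 < mu - 1 by lra.
have mu2 : 0 < mu ^+ 2 - 1.
  by rewrite (_ : _ - 1 = (mu - 1) * (mu + 1)); [rewrite mulr_gt0 //; lra | ring].
have U : 0 < mu * (m + k) + (k - m) by nra.
have V : (m + k) + mu * (k - m) < 0 by nra.
have n0 := lt0r_neq0 mu0; have n1 := lt0r_neq0 mu1; have n2 := lt0r_neq0 mu2.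
split; split.
- by rewrite divr_gt0.
- rewrite -subr_gt0 (_ : _ - _ = - ((m + k) + mu * (k - m)) / (mu * (mu ^+ 2 - 1))); last first.
    by field; rewrite n0 n2.
  by rewrite divr_gt0 ?mulr_gt0 // oppr_gt0.
- by rewrite ltr_pdivrMr //; nra.
- by rewrite ltr_pdivlMr //; nra.
- rewrite -subr_gt0 (_ : _ - _ = (m - k) / (mu * (mu - 1))); last by field; rewrite n0 n1.
  by rewrite divr_gt0 ?mulr_gt0 //; lra.
- rewrite -subr_gt0 (_ : _ - _ = (mu * (m + k) + (k - m)) / (mu * (mu ^+ 2 - 1))); last first.
    by field; rewrite n0 n2.
  by rewrite divr_gt0 ?mulr_gt0.
by rewrite -oppr_gt0 -mulNr divr_gt0 // oppr_gt0.
Qed.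

(** * First-order condition at a maximizer *)

Section EigenEquation.
Variables (R : realFieldType) (n : nat) (e : rel 'I_n) (M : R).
Hypotheses (sg : simple_graph e) (M0 : 0 < M).
Hypothesis ub : forall y : 'I_n -> R, qf e y <= M * sqnorm y.

Lemma sqnorm_ge0 (x : 'I_n -> R) : 0 <= sqnorm x.
Proof. by apply: sumr_ge0 => i _; exact: sqr_ge0. Qed.

Lemma sqnorm_eq0 (x : 'I_n -> R) i : sqnorm x = 0 -> x i = 0.
Proof.
move=> /psumr_eq0P => /(_ (fun j _ => sqr_ge0 (x j))) /(_ i isT) /eqP.
by rewrite expf_eq0 => /eqP.
Qed.

Lemma sqnorm_perturb (x : 'I_n -> R) v t :
  sqnorm (fun i => x i + (i == v)%:R * t) = sqnorm x + 2 * t * x v + t ^+ 2.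
Proof.
rewrite /sqnorm (bigD1 v) //= [in RHS](bigD1 v) //= eqxx mul1r.
under eq_bigr => i iv do rewrite (negbTE iv) mul0r addr0.
ring.
Qed.

Lemma qf_perturb (x : 'I_n -> R) v t :
  qf e (fun i => x i + (i == v)%:R * t) =
  qf e x + 2 * t * (\sum_w (e v w)%:R * x w - \sum_i x i) - t ^+ 2.
Proof.
case: sg => sE iE; rewrite /qf.
have E i j : (e i j)%:R * ((x i + (i == v)%:R * t) * (x j + (j == v)%:R * t)) =
  (e i j)%:R * (x i * x j) + ((i == v) && true)%:R * (t * ((e i j)%:R * x j)) +
  ((j == v) && true)%:R * (t * ((e i j)%:R * x i)) +
  ((i == v) && (j == v))%:R * (t ^+ 2 * (e i j)%:R).
  by rewrite !andbT -mulnb natrM; ring.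
under eq_bigr => i _ do (under eq_bigr => j _ do rewrite E).
under eq_bigr => i _ do rewrite !big_split /=.
rewrite !big_split /= !sum_pair_point big_pred1_eq iE.
rewrite [X in _ + X + _]exchange_big sum_pair_point /=.
under [X in _ + X + _]eq_bigr => j _ do rewrite sE.
rewrite -!big_distrr /=.
have -> : \sum_i (i == v)%:R * t = t.
  rewrite (bigD1 v) //= eqxx big1 ?mul1r ?addr0 // => i /negbTE->; exact: mul0r.
ring.
Qed.

(** Changing one coordinate by [t] keeps [M * sqnorm - qf] nonnegative, and it vanishes at [t = 0];
    hence its linear coefficient is 0. *)
Lemma eigen_equation (x : 'I_n -> R) v : qf e x = M * sqnorm x ->
  M * x v = \sum_w (e v w)%:R * x w - \sum_i x i.
Proof.
move=> Ex; apply/eqP; rewrite -subr_eq0; set g := _ - _.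
have H t : 0 <= 2 * t * g + t ^+ 2 * (M + 1).
  have := ub (fun i => x i + (i == v)%:R * t); rewrite sqnorm_perturb qf_perturb Ex /g.
  move: (\sum_w _) => S1; lra.
have M1 : 0 < M + 1 by rewrite addr_gt0.
(* This value of [t] minimizes the quadratic. *)
have := H (- g / (M + 1)).
rewrite (_ : _ + _ = - (g ^+ 2 / (M + 1))); last by field; rewrite gt_eqF.
by rewrite oppr_ge0 pmulr_lle0 ?invr_gt0 // real_exprn_even_le0 ?num_real.
Qed.
End EigenEquation.

Lemma delta_small (R : realFieldType) (mu : R) (a b : nat) : 3 < mu ->
  (a + 2 = b + 4 \/ a + 2 = b + 5)%N -> 9 * delta mu a%:R b%:R ^+ 2 <= 1.
Proof.
move=> mu3 h; have m0 : 0 < mu by lra.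
have m1 : 0 < mu - 1 by lra.
pose th := 2 / (mu - 1).
have th0 : 0 < th by rewrite divr_gt0 ?ltr0n.
have th1 : th < 1 by rewrite ltr_pdivrMr // mul1r; lra.
have [j Ej jr] : exists2 j : R, b%:R - a%:R + 2 = j & j = 0 \/ j = -1.
  case: h => h; [exists 0|exists (-1)]; try (by [left|right]).
    have -> : a = b.+2 by lia.
    by rewrite -addn2 natrD; ring.
  have -> : a = b.+3 by lia.
  by rewrite -addn3 natrD; ring.
have -> : delta mu a%:R b%:R = (j + th) / mu.
  by rewrite -Ej /delta /th; field; rewrite !gt_eqF.
rewrite expr_div_n mulrA ler_pdivrMr ?exprn_gt0 // mul1r.
have : (j + th) ^+ 2 <= 1 by case: jr => ->; nra.
have : 9 <= mu ^+ 2 by nra.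
lra.
Qed.

Section NullVector.
Variables (R : realFieldType) (n : nat).
Variables (P : {set 'I_n}) (c u d w t1 t2 : 'I_n) (M : R) (x : 'I_n -> R).
Hypothesis ok : double_star_ok P c u d w t1 t2.
Hypothesis M3 : 3 < M.
Hypothesis balanced : (#|P| = #|~: P| \/ #|P| = #|~: P| + 1)%N.
Hypothesis ub : forall y : 'I_n -> R, phi P c u d w t1 t2 y <= M * sqnorm y.
Hypothesis Ex : phi P c u d w t1 t2 x = M * sqnorm x.
Hypothesis xcd : x d < x c.

Let G := double_star P c u d w t1 t2.
Let s := \sum_i x i.
Let C := x c - s.
Let D := x d - s.

Lemma double_star_simple : simple_graph G.
Proof.
split=> a; first by move=> b; rewrite /G /double_star orbC.
by rewrite /G /double_star /double_star_dir; case: (double_starP a ok).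
Qed.

Lemma sum_indicator (a : 'I_n) : \sum_i (i == a)%:R * x i = x a.
Proof.
by rewrite (bigD1 a) //= eqxx mul1r big1 ?addr0 // => i /negbTE->; rewrite mul0r.
Qed.

Lemma null_row v : M * x v = \sum_i (G v i)%:R * x i - s.
Proof.
apply: eigen_equation; first exact: double_star_simple.
- by have := M3; lra.
- by move=> y; rewrite qf_double_star.
by rewrite qf_double_star.
Qed.

Lemma null_row1 v a : (forall i, G v i = (i == a)) -> x v = (x a - s) / M.
Proof.
move=> E; have := null_row v; under eq_bigr => i _ do rewrite E.
rewrite sum_indicator => <-; rewrite mulrC mulKf // gt_eqF //; have := M3; lra.
Qed.

(** For the vertices of degree two: the ends of the joining edge and of the added triangle edge. *)
Lemma null_row2 v a b : (forall i, G v i = (i == a) + (i == b) :> nat)%N ->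
  M * x v = x a + x b - s.
Proof.
move=> E; rewrite null_row; under eq_bigr => i _ do rewrite E natrD mulrDl.
by rewrite big_split /= !sum_indicator.
Qed.

Lemma null_leaf1 i : i \in leaf1 P c u -> x i = C / M.
Proof.
rewrite inE => il; apply: null_row1 => j; rewrite /G /double_star /double_star_dir.
by case: (double_starP i ok) il => //= _; case: (double_starP j ok).
Qed.

Lemma null_leaf2 i : i \in leaf2 P d w t1 t2 -> x i = D / M.
Proof.
rewrite !inE => il; apply: null_row1 => j; rewrite /G /double_star /double_star_dir.
by case: (double_starP i ok) il => //= _; case: (double_starP j ok).
Qed.

Lemma null_values : [/\ x u = (M * C + D) / (M ^+ 2 - 1),
  x w = (C + M * D) / (M ^+ 2 - 1), x t1 = D / (M - 1) & x t2 = D / (M - 1)].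
Proof.
have Eu : M * x u = x c + x w - s.
  apply: null_row2 => j; rewrite /G /double_star /double_star_dir.
  by case: (double_starP u ok) (eqxx u) => //= _; case: (double_starP j ok).
have Ew : M * x w = x d + x u - s.
  apply: null_row2 => j; rewrite /G /double_star /double_star_dir.
  by case: (double_starP w ok) (eqxx w) => //= _; case: (double_starP j ok).
have E1 : M * x t1 = x d + x t2 - s.
  apply: null_row2 => j; rewrite /G /double_star /double_star_dir.
  by case: (double_starP t1 ok) (eqxx t1) => //= _; case: (double_starP j ok).
have E2 : M * x t2 = x d + x t1 - s.
  apply: null_row2 => j; rewrite /G /double_star /double_star_dir.
  by case: (double_starP t2 ok) (eqxx t2) => //= _; case: (double_starP j ok).
have n1 : M - 1 != 0 by rewrite gt_eqF //; have := M3; lra.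
have n2 : M + 1 != 0 by rewrite gt_eqF //; have := M3; lra.
have n3 : M ^+ 2 - 1 != 0.
  by rewrite (_ : _ - 1 = (M - 1) * (M + 1)); [rewrite mulf_neq0|ring].
have E12 : x t1 = x t2.
  apply: (mulfI n2); rewrite !mulrDl !mul1r E1 E2; ring.
split.
- apply: (mulIf n3); rewrite divfK // /C /D.
  rewrite (_ : x u * (M ^+ 2 - 1) = M * (M * x u) - x u); last by ring.
  rewrite Eu (_ : M * (x c + x w - s) = M * (x c - s) + M * x w); last by ring.
  by rewrite Ew; ring.
- apply: (mulIf n3); rewrite divfK // /C /D.
  rewrite (_ : x w * (M ^+ 2 - 1) = M * (M * x w) - x w); last by ring.
  rewrite Ew (_ : M * (x d + x u - s) = M * (x d - s) + M * x u); last by ring.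
  by rewrite Eu; ring.
- by apply: (mulIf n1); rewrite divfK // /D mulrBr mulr1 mulrC E1 E12; ring.
by apply: (mulIf n1); rewrite divfK // /D mulrBr mulr1 mulrC E2 E12; ring.
Qed.

(** For an eigenvector all residuals and leaf variances vanish, so [reduction_identity] becomes the
    equation required by [null_vector_bounds]. *)
Lemma null_small : 9 * ((C + D) / 2) ^+ 2 <= ((C - D) / 2) ^+ 2 /\
  81 * (s + (C + D) / 2) ^+ 2 <= ((C - D) / 2) ^+ 2.
Proof.
have M1 : 1 < M by have := M3; lra.
(* The threshold is a value of the form [M * sqnorm - phi], which is nonnegative by assumption. *)
have th : 0 <= threshold M #|leaf1 P c u|%:R #|leaf2 P d w t1 t2|%:R.
  by have [y <-] := phi_attained ok M1; rewrite subr_ge0.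
apply: (null_vector_bounds M3 (ler0n _ _) (ler0n _ _) th).
  apply: delta_small => //; move: balanced.
  rewrite -(card_leaf1 ok) -(card_leaf2 ok); case=> H; [left|right]; lia.
have := @reduction_identity R M #|leaf1 P c u|%:R #|leaf2 P d w t1 t2|%:R M1
  (x c) (x u) (x d) (x w) (x t1) (x t2) (\sum_(i in leaf1 P c u) x i)
  (\sum_(i in leaf2 P d w t1 t2) x i) (\sum_(i in leaf1 P c u) x i ^+ 2)
  (\sum_(i in leaf2 P d w t1 t2) x i ^+ 2).
have Es : x c + x u + \sum_(i in leaf1 P c u) x i +
  (x d + x w + x t1 + x t2 + \sum_(i in leaf2 P d w t1 t2) x i) = s.
  by rewrite /s (sum_double_star ok).
have [Eu Ew E1 E2] := null_values.
have := Ex; rewrite /phi /sqnorm (sum_side1 ok) (sum_side2 ok) !(sum_double_star ok).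
rewrite Es -/C -/D Eu Ew E1 E2 !subrr => /eqP; rewrite -subr_eq0 => /eqP Z0.
rewrite -opprB Z0 oppr0.
have S1 : \sum_(i in leaf1 P c u) x i = #|leaf1 P c u|%:R * (C / M).
  by rewrite mulr_natl -sumr_const; apply: eq_bigr => i; exact: null_leaf1.
have S2 : \sum_(i in leaf2 P d w t1 t2) x i = #|leaf2 P d w t1 t2|%:R * (D / M).
  by rewrite mulr_natl -sumr_const; apply: eq_bigr => i; exact: null_leaf2.
have Q1 : \sum_(i in leaf1 P c u) x i ^+ 2 = #|leaf1 P c u|%:R * (C / M) ^+ 2.
  by rewrite mulr_natl -sumr_const; apply: eq_bigr => i /null_leaf1->.
have Q2 : \sum_(i in leaf2 P d w t1 t2) x i ^+ 2 = #|leaf2 P d w t1 t2|%:R * (D / M) ^+ 2.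
  by rewrite mulr_natl -sumr_const; apply: eq_bigr => i /null_leaf2->.
rewrite S1 S2 Q1 Q2 => ->; move: (sigma _ _ _) (wgt _ _ _) => sg h.
move: (#|leaf1 P c u|%:R) (#|leaf2 P d w t1 t2|%:R) => k1 k2.
by rewrite -!mulrA !subrr; ring.
Qed.

Lemma null_profile :
  [/\ 0 < x u, x u < C / M & C / M < x c] /\
  [/\ x d < D / (M - 1), D / (M - 1) < D / M, D / M < x w & x w < 0].
Proof.
have [Eu Ew _ _] := null_values; have [b1 b2] := null_small.
have CD : 0 < C - D by rewrite /C /D; have := xcd; lra.
have := star_profile M3 CD b1 b2; rewrite -Eu -Ew.
have -> : C + s = x c by rewrite /C subrK.
by have -> : D + s = x d by rewrite /D subrK.
Qed.

Lemma null_strict :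
  [/\ forall a, a \in P -> 0 < x a, forall a, a \in P -> a != c -> x a < x c &
      forall a, a \in P -> a != u -> x u < x a] /\
  [/\ forall a, a \notin P -> x a < 0, forall a, a \notin P -> a != d -> x d < x a,
      forall a, a \notin P -> a != w -> x a < x w &
      forall a, a \notin P -> a \notin [:: d; t1; t2] -> x t1 < x a /\ x t2 < x a].
Proof.
have [[u0 uy yc] [dt tz zw w0]] := null_profile.
have [_ _ E1 E2] := null_values.
have V1 a : a \in P -> [\/ a = c, a = u | x a = C / M].
  move=> aP; have := @null_leaf1 a; rewrite inE aP.
  have [->|_] := eqVneq a c; first by constructor 1.
  by have [->|_ H] := eqVneq a u; [constructor 2|constructor 3; apply: H].
have V2 a : a \notin P ->
    a = d \/ a = w \/ x a = D / (M - 1) \/ a \notin [:: d; t1; t2] /\ x a = D / M.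
  move=> aP; have := @null_leaf2 a; rewrite !inE aP /=.
  have [->|_] := eqVneq a d; first by left.
  have [->|_] := eqVneq a w; first by right; left.
  have [->|_] := eqVneq a t1; first by right; right; left.
  have [->|_ H] := eqVneq a t2; first by right; right; left.
  by right; right; right; split=> //; apply: H.
split; split.
- by move=> a /V1[->|->|->]; lra.
- by move=> a /V1[->|->|->]; rewrite ?eqxx // => _; lra.
- by move=> a /V1[->|->|->]; rewrite ?eqxx // => _; lra.
- by move=> a /V2[->|[->|[->|[_ ->]]]]; lra.
- by move=> a /V2[->|[->|[->|[_ ->]]]]; rewrite ?eqxx // => _; lra.
- by move=> a /V2[->|[->|[->|[_ ->]]]]; rewrite ?eqxx // => _; lra.
move=> a aP an; rewrite E1 E2; suff : D / (M - 1) < x a by [].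
have := @null_leaf2 a; move: an; rewrite !inE !negb_or aP => /and3P[-> -> ->] /=.
by have [->|_ ->] := eqVneq a w => //; lra.
Qed.
End NullVector.

(** * The comparison for real vectors *)

Lemma ex_argmin (R : realDomainType) (I : finType) (A : {set I}) (F : I -> R) :
  (0 < #|A|)%N -> exists2 i, i \in A & forall j, j \in A -> F i <= F j.
Proof.
move=> /card_gt0P[i0 i0A].
by case: (arg_minP F i0A) => i iA H; exists i.
Qed.

Lemma qf_opp (R : realFieldType) n (e : rel 'I_n) (x : 'I_n -> R) :
  qf e (fun i => - x i) = qf e x.
Proof.
rewrite /qf sumrN sqrrN; congr (_ - _).
by apply: eq_bigr => i _; apply: eq_bigr => j _; rewrite mulrNN.
Qed.

Lemma sqnorm_opp (R : realFieldType) n (x : 'I_n -> R) : sqnorm (fun i => - x i) = sqnorm x.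
Proof. by apply: eq_bigr => i _; rewrite sqrrN. Qed.

(** The squared total contains every product [x i * x j], the edge sum only some of them. *)
Lemma qf_same_sign (R : realFieldType) n (e : rel 'I_n) (x : 'I_n -> R) :
  (forall i j, 0 <= x i * x j) -> qf e x <= 0.
Proof.
move=> x0; rewrite subr_le0 expr2 big_distrl /=; apply: ler_sum => i _.
rewrite big_distrr /=; apply: ler_sum => j _.
by case: (e i j); rewrite ?mul1r ?mul0r.
Qed.

(** With at most three vertices in [P], the squared sum over [P] is at most three times the sum of
    squares there; expanding the squared total absorbs the star at [d]. *)
Lemma small_side (R : realFieldType) n (e : rel 'I_n) (x : 'I_n -> R)
    (P : {set 'I_n}) c d f g :
  simple_graph e -> e f g ->
  (forall a b, connect (del_edge e f g) a b) ->
  (forall a b, del_edge e f g a b -> ~~ connect (del_edge (del_edge e f g) a b) a b) ->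
  c \in P -> d \notin P ->
  (forall a, a \in P -> 0 <= x a) -> (forall a, a \notin P -> x a <= 0) ->
  (forall a, a \in P -> x a <= x c) -> (forall a, a \notin P -> x d <= x a) ->
  ((f \in P) != (g \in P)) || [&& f != c, f != d, g != c & g != d] ->
  (#|P| <= 3)%N -> qf e x <= 3 * sqnorm x.
Proof.
move=> sg efg con brg cP dP xP xN xc xd good P3.
have symT : symmetric (del_edge e f g) by apply: del_edge_sym; case: sg.
have fg : f != g by case: sg => _ iE; apply: contraTneq efg => ->; rewrite iE.
have := signed_tree_bound symT con brg cP dP xP xN xc xd.
rewrite /qf (sum_del_edge x sg efg); move: (\sum_a \sum_b _) => S0.
have splitP (F : 'I_n -> R) : \sum_i F i = \sum_(i in P) F i + (F d + \sum_(i in ~: P | i != d) F i).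
  rewrite (bigID (mem P)) /= (bigD1 d (P := fun i => i \notin P)) //=.
  by congr (_ + (_ + _)); apply: eq_bigl => i; rewrite inE.
have sumPc : \sum_(i in P) x i = x c + \sum_(i in P | i != c) x i by rewrite (bigD1 c).
rewrite /sqnorm !splitP.
(* Deviations from a third of the sum, rather than from the mean, serve all sizes up to 3 at
   once. *)
have := variance_bound P x ((\sum_(i in P) x i) / 3) 0.
have k3 : #|P|%:R <= 3 :> R by rewrite ler_nat.
have B0 : 0 <= \sum_(i in ~: P | i != d) x i ^+ 2 by apply: sumr_ge0 => i _; exact: sqr_ge0.
have A0 : 0 <= \sum_(i in P) x i ^+ 2 by apply: sumr_ge0 => i _; exact: sqr_ge0.
(* The deleted edge is paid for by squares outside [P], unless it lies in [P] away from [c]. In that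
   case [P] consists of [c], [f] and [g], and the three products are at most the sum of squares. *)
have fgb : 2 * (x f * x g) <= \sum_(i in ~: P | i != d) x i ^+ 2 \/
  2 * (x c * \sum_(i in P | i != c) x i) + 2 * (x f * x g) <= 2 * \sum_(i in P) x i ^+ 2.
  case fP: (f \in P) good; case gP: (g \in P) => //= good.
  - right; case/and4P: good => fc _ gc _.
    have E (F : 'I_n -> R) : \sum_(i in P | i != c) F i = F f + F g.
      rewrite (bigD1 f) ?fP //= (bigD1 g) /=; last by rewrite gP gc eq_sym.
      rewrite big1 ?addr0 // => i /andP[/andP[/andP[iP ic] jf] ig]; exfalso.
      move: P3; rewrite leqNgt => /negP[].
      rewrite (cardsD1 c) (cardsD1 f) (cardsD1 g) (cardsD1 i) !inE.
      by rewrite cP fP gP iP ic jf ig fc gc (eq_sym g) fg.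
    rewrite (bigD1 c cP) /= !E; have := sqr_ge0 (x c - x f).
    have := sqr_ge0 (x c - x g); have := sqr_ge0 (x f - x g); nra.
  - left; apply: le_trans B0; rewrite pmulr_rle0 ?ltr0n //.
    by rewrite mulr_ge0_le0 ?xP ?xN ?gP.
  - left; apply: le_trans B0; rewrite pmulr_rle0 ?ltr0n //.
    by rewrite mulr_le0_ge0 ?xP ?xN ?fP.
  left; case/and4P: good => _ fd _ gd.
  rewrite (bigD1 f) ?inE ?fP //= (bigD1 g) /=; last by rewrite inE gP gd eq_sym.
  set r := \sum_(i | _) _.
  have : 0 <= r by apply: sumr_ge0 => i _; exact: sqr_ge0.
  have := sqr_ge0 (x f - x g); nra.
move: fgb A0 B0 sumPc k3.
move: (\sum_(i in P | _) x i) (\sum_(i in P) x i) (\sum_(i in P) _)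
  (\sum_(i in ~: P | _) x i) (\sum_(i in ~: P | _) _) (#|P|%:R) (x f * x g) (x c) (x d).
move=> Ac A A2 B B2 k fg2 xc' xd' fgb A0 B0 EA k3 V T.
have A3 : A ^+ 2 <= 3 * A2.
  have := sqr_ge0 A; move: V; rewrite mulr0 mul0r expr0n /= mul0r subr0.
  rewrite expr_div_n (_ : 2 * (A / 3) * A = 2 / 3 * A ^+ 2); last by field.
  move: (A ^+ 2) => Q; rewrite (_ : 3 ^+ 2 = 9); last by ring.
  move=> V Q0; have : k * (Q / 9) <= 3 * (Q / 9) by rewrite ler_wpM2r // divr_ge0 ?ler0n.
  lra.
(* Once the product of [xd'] and [B] cancels, [Z1] discards [(A + B) ^+ 2], [Z2] bounds the product
   of [A] and [xd'], and [Z3] bounds the star at [c] by [A ^+ 2 / 2]. *)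
have Z1 := sqr_ge0 (A + B); have Z2 := sqr_ge0 (xd' * 2 + A / 2).
have Z3 := sqr_ge0 (A - 2 * xc').
case: fgb => H; nra.
Qed.

Lemma card_ord_lt n k : (k <= n)%N -> #|[set i : 'I_n | (i < k)%N]| = k.
Proof.
move=> kn; rewrite -sum1dep_card -(big_ord_widen n (fun _ => 1%N) kn).
by rewrite sum1_card card_ord.
Qed.

Lemma Uext_double_star n : (20 <= n)%N -> exists P c u d w t1 t2,
  [/\ double_star_ok P c u d w t1 t2, @Uext n =2 double_star P c u d w t1 t2 &
      #|P| = (uphalf (n - 2)).+1].
Proof.
move=> n20; set p := uphalf (n - 2); set q := ((n - 2)./2)%N.
have pq : (p + q + 2 = n)%N.
  by rewrite /p /q; lia.
have p9 : (9 <= p)%N by rewrite /p; lia.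
have q9 : (9 <= q)%N by rewrite /q; lia.
have l0 : (0 < n)%N by lia.
have l1 : (1 < n)%N by lia.
have l2 : (p.+1 < n)%N by lia.
have l3 : (p.+2 < n)%N by lia.
have l4 : (p + q < n)%N by lia.
have l5 : (p + q + 1 < n)%N by lia.
exists [set i : 'I_n | (i < p.+1)%N], (Ordinal l0), (Ordinal l1), (Ordinal l2),
  (Ordinal l3), (Ordinal l4), (Ordinal l5).
split; last by rewrite card_ord_lt //; lia.
  rewrite /double_star_ok /= !inE -!val_eqE /=; lia.
have E : forall i j : 'I_n, Upq_dir p q i j = double_star_dir
  [set i : 'I_n | (i < p.+1)%N] (Ordinal l0) (Ordinal l1) (Ordinal l2)
  (Ordinal l3) (Ordinal l4) (Ordinal l5) i j.
  move=> i j; rewrite /Upq_dir /double_star_dir !inE -!val_eqE /=.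
  have := ltn_ord i; have := ltn_ord j; rewrite -[X in (_ < X)%N]pq.
  move: (nat_of_ord i) (nat_of_ord j) => a b bn an.
  congr [|| _ && _, _ && _ | _]; lia.
by move=> i j; rewrite /Uext /Ugraph /Upq /double_star -/p -/q !E.
Qed.

Lemma card_setD1_gt (T : finType) (A : {set T}) a k :
  (k.+1 < #|A|)%N -> (k < #|A :\ a|)%N.
Proof. by rewrite (cardsD1 a A); case: (a \in A) => //= /ltnW. Qed.

Lemma uphalf_balanced (n a b : nat) : (20 <= n)%N -> (a + b = n)%N ->
  a = (uphalf (n - 2)).+1 -> (a = b \/ a = b + 1)%N.
Proof. lia. Qed.

Section Comparison.
Variables (R : realFieldType) (n : nat) (e : rel 'I_n) (M : R).
Hypotheses (n20 : (20 <= n)%N) (sg : simple_graph e) (uni : unicyclic e).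
Hypothesis ub : forall y : 'I_n -> R, qf (@Uext n) y <= M * sqnorm y.

Lemma eq_qf (e1 e2 : rel 'I_n) (y : 'I_n -> R) : e1 =2 e2 -> qf e1 y = qf e2 y.
Proof.
by move=> E; congr (_ - _); apply: eq_bigr => i _; apply: eq_bigr => j _; rewrite E.
Qed.

(** For [n >= 20] both sides have at least 10 vertices, which leaves the 8 and 6 leaves needed by
    [phi_gt3]. *)
Lemma Uext_bound_gt3 : 3 < M.
Proof.
have [P [c [u [d [w [t1 [t2 [ok E cP]]]]]]]] := Uext_double_star n20.
have [||y] := @phi_gt3 R n P c u d w t1 t2 ok.
- have := card_leaf1 ok; rewrite cP uphalf_half.
  have := odd_double_half (n - 2); lia.
- have := card_leaf2 ok; have := cardsC P; rewrite card_ord cP uphalf_half.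
  have := odd_double_half (n - 2).
  move: #|leaf2 P d w t1 t2| #|~: P| => l r; lia.
rewrite -(qf_double_star y ok) -(eq_qf _ E) => /lt_le_trans/(_ (ub y)).
move=> H; have y0 : 0 < sqnorm y.
  by rewrite lt_neqAle sqnorm_ge0 andbT; apply: contraTneq H => <-; rewrite !mulr0 ltxx.
by rewrite ltr_pM2r in H.
Qed.

Lemma large_sides (x : 'I_n -> R) (P : {set 'I_n}) c d f g :
  e f g ->
  (forall a b, connect (del_edge e f g) a b) ->
  (forall a b, del_edge e f g a b -> ~~ connect (del_edge (del_edge e f g) a b) a b) ->
  c \in P -> d \notin P ->
  (forall a, a \in P -> 0 <= x a) -> (forall a, a \notin P -> x a <= 0) ->
  (forall a, a \in P -> x a <= x c) -> (forall a, a \notin P -> x d <= x a) ->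
  ((f \in P) != (g \in P)) \/ [/\ f \notin P, g \notin P, f != d & g != d] ->
  (3 < #|P|)%N -> (3 < #|~: P|)%N -> 0 < sqnorm x ->
  qf e x <= M * sqnorm x /\ (qf e x = M * sqnorm x -> gisomorphic e (@Uext n)).
Proof.
move=> efg con brg cP dP xP xN xc xd fgc P3 N3 x0.
have M3 := Uext_bound_gt3.
have [P' [c' [u' [d' [w' [t1' [t2' [ok' E' cP']]]]]]]] := Uext_double_star n20.
have [u uPc umin] : exists2 u, u \in P :\ c & forall a, a \in P :\ c -> x u <= x a.
  by apply: ex_argmin; do 2 apply: ltnW; exact: card_setD1_gt.
have [t1 t1P t1min] : exists2 t, t \in ~: P :\ d & forall a, a \in ~: P :\ d -> x t <= x a.
  by apply: ex_argmin; do 2 apply: ltnW; exact: card_setD1_gt.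
have c2 : (2 < #|~: P :\ d|)%N by exact: card_setD1_gt.
have c3 : (1 < #|~: P :\ d :\ t1|)%N by exact: card_setD1_gt.
have [t2 t2P t2min] : exists2 t, t \in ~: P :\ d :\ t1 &
    forall a, a \in ~: P :\ d :\ t1 -> x t <= x a.
  by apply: ex_argmin; exact: ltnW.
have c4 : (0 < #|~: P :\ d :\ t1 :\ t2|)%N by exact: card_setD1_gt.
(* Choosing [w] after [d], [t1] and [t2] keeps the four vertices distinct; this is where four
   vertices outside [P] are required. The entry at [w] is still the largest one there. *)
have [w wP wmax] : exists2 t, t \in ~: P :\ d :\ t1 :\ t2 &
    forall a, a \in ~: P :\ d :\ t1 :\ t2 -> - x t <= - x a by apply: ex_argmin.
have ok : double_star_ok P c u d w t1 t2.
  move: uPc t1P t2P wP; rewrite /double_star_ok !inE /= !inE !negb_or cP dP.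
  move=> /andP[-> ->] /andP[d1 ->] /and3P[d21 d2 ->] /and4P[w2 w1 wd ->].
  by rewrite !andbT /= (eq_sym d) wd (eq_sym d) d1 (eq_sym d) d2 w1 w2 (eq_sym t1) d21.
have xu a : a \in P -> x u <= x a.
  move=> aP; have [->|ac] := eqVneq a c; last by apply: umin; rewrite !inE ac.
  by apply: xc; case/setD1P: uPc.
have wN : w \notin P by move: wP; rewrite !inE => /and4P[].
have xw a : a \notin P -> x a <= x w.
  move=> aP; have [->|ad] := eqVneq a d; first exact: xd.
  have [->|a1] := eqVneq a t1.
    by apply: t1min; move: wP; rewrite !inE => /and4P[_ _ -> ->].
  have [->|a2] := eqVneq a t2.
    by apply: t2min; move: wP; rewrite !inE => /and4P[_ -> -> ->].
  by rewrite -lerN2; apply: wmax; rewrite !inE ad a1 a2.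
have xt a : a \notin P -> a \notin [:: d; t1; t2] -> x t1 <= x a /\ x t2 <= x a.
  move=> aP; rewrite !inE !negb_or => /and3P[ad a1 a2].
  by split; [apply: t1min|apply: t2min]; rewrite !inE ad ?a1.
have B := unicyclic_bound sg ok efg con brg fgc xP xN xc xd xu xw xt.
have M1 : 1 < M by apply: lt_trans M3; rewrite (ltr_nat R 1 3).
have ub' y : phi P' c' u' d' w' t1' t2' y <= M * sqnorm y.
  by rewrite -(qf_double_star y ok') -(eq_qf _ E').
have th' : 0 <= threshold M #|leaf1 P' c' u'|%:R #|leaf2 P' d' w' t1' t2'|%:R.
  by have [y <-] := phi_attained ok' M1; rewrite subr_ge0.
(* If these extreme entries coincided, all entries would be 0. *)
have xcd : x d < x c.
  rewrite lt_neqAle (le_trans (xN d dP) (xP c cP)) andbT; apply: contraTneq x0 => Edc.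
  rewrite -leNgt le_eqVlt; apply/orP; left; apply/eqP.
  rewrite /sqnorm big1 // => i _; have c0 := xP c cP; have d0 := xN d dP.
  have ce : x c = 0 by apply/eqP; rewrite eq_le c0 -Edc d0.
  suff -> : x i = 0 by rewrite expr0n.
  apply/eqP; rewrite eq_le; have [iP|iP] := boolP (i \in P).
    by rewrite xP // -ce xc.
  by rewrite xN // -ce -Edc xd.
have PB y := phi_bound ok y M1.
have m0 : 0 < ((x c - x d) / 2) ^+ 2.
  by rewrite exprn_gt0 // divr_gt0 ?ltr0n // subr_gt0.
have L1 := card_leaf1 ok; have L2 := card_leaf2 ok.
have L1' := card_leaf1 ok'; have L2' := card_leaf2 ok'.
have PP : (#|P| + #|~: P| = #|P'| + #|~: P'|)%N by rewrite !cardsC.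
have bal : (#|P'| = #|~: P'| \/ #|P'| = #|~: P'| + 1)%N.
  by apply: (@uphalf_balanced n) => //; rewrite cardsC card_ord.
(* If the sides differ in size from those of the extremal graph, [threshold_lt] makes the threshold
   positive and the bound strict. *)
have [El|nl] := eqVneq #|leaf1 P c u| #|leaf1 P' c' u'|; last first.
  have : 0 < threshold M #|leaf1 P c u|%:R #|leaf2 P d w t1 t2|%:R.
    apply: le_lt_trans th' _; apply: threshold_lt => //.
      by rewrite L1 L2 L1' L2'.
    by rewrite L1' -[5%N]/(4 + 1)%N addnA L2'.
  move=> thp; have := lt_le_trans (mulr_gt0 thp m0) (PB x).
  rewrite subr_gt0 => /(le_lt_trans B) lt; split; first exact: ltW.
  by move=> E; rewrite E ltxx in lt.
have EP : #|P| = #|P'| by rewrite -L1 -L1' El.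
have El2 : #|leaf2 P d w t1 t2| = #|leaf2 P' d' w' t1' t2'|.
  by apply/eqP; rewrite -(eqn_add2r 4) L2 L2' -(eqn_add2l #|P|) PP EP.
have ub2 y : phi P c u d w t1 t2 y <= M * sqnorm y.
  rewrite -subr_ge0; apply: le_trans (PB y); rewrite El El2.
  by rewrite mulr_ge0 // sqr_ge0.
split; first exact: le_trans B (ub2 x).
move=> Eq.
have Ex : phi P c u d w t1 t2 x = M * sqnorm x.
  by apply/eqP; rewrite eq_le ub2 -Eq B.
have bal2 : (#|P| = #|~: P| \/ #|P| = #|~: P| + 1)%N.
  by rewrite EP; have -> : #|~: P| = #|~: P'| by rewrite -L2 -L2' El2.
have [[s1 s2 s3] [s4 s5 s6 s7]] := null_strict ok M3 bal2 ub2 Ex xcd.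
have Ee := unicyclic_bound_eq sg ok efg con brg fgc xP xN xc xd xu xw xt s1 s4 s2 s5 s3 s6 s7.
have {}Ee := Ee (etrans Eq (esym Ex)).
have [h [bh H]] := double_star_iso ok ok' EP.
by exists h; split=> // a b; rewrite E' H Ee.
Qed.

Lemma unicyclic_comparison (x : 'I_n -> R) : 0 < sqnorm x ->
  qf e x <= M * sqnorm x /\ (qf e x = M * sqnorm x -> gisomorphic e (@Uext n)).
Proof.
move=> x0; have M3 := Uext_bound_gt3.
have small : qf e x <= 3 * sqnorm x ->
  qf e x <= M * sqnorm x /\ (qf e x = M * sqnorm x -> gisomorphic e (@Uext n)).
  move=> H; have H2 : 3 * sqnorm x < M * sqnorm x by rewrite ltr_pM2r.
  have lt := le_lt_trans H H2; split; first exact: ltW.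
  by move=> E; rewrite E ltxx in lt.
pose P := [set i | 0 <= x i].
have xP a : a \in P -> 0 <= x a by rewrite inE.
have xN a : a \notin P -> x a <= 0 by rewrite inE -ltNge => /ltW.
have [P0|Pn] := posnP #|P|.
  apply: small; apply: (@le_trans _ _ 0); last by rewrite mulr_ge0 ?sqnorm_ge0.
  apply: qf_same_sign => i j; rewrite mulr_le0 // xN //.
    by have /eqP := P0; rewrite cards_eq0 => /eqP->; rewrite inE.
  by have /eqP := P0; rewrite cards_eq0 => /eqP->; rewrite inE.
have [N0|Nn] := posnP #|~: P|.
  apply: small; apply: (@le_trans _ _ 0); last by rewrite mulr_ge0 ?sqnorm_ge0.
  have aP i : i \in P.
    have /eqP := N0; rewrite cards_eq0 => /eqP/setP/(_ i).
    by rewrite inE [in RHS]inE => /negbFE.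
  by apply: qf_same_sign => i j; rewrite mulr_ge0 // xP.
have [c cP xc] : exists2 c, c \in P & forall a, a \in P -> - x c <= - x a by exact: ex_argmin.
have [d dP xd] : exists2 d, d \in ~: P & forall a, a \in ~: P -> x d <= x a by exact: ex_argmin.
have {}xc a : a \in P -> x a <= x c by move=> aP; rewrite -lerN2; exact: xc.
have {}xd a : a \notin P -> x d <= x a by move=> aP; apply: xd; rewrite inE.
have {}dP : d \notin P by rewrite inE in dP.
have [f [g [efg good con brg]]] := unicyclic_spanning_tree sg uni cP dP.
pose x' := fun i => - x i.
have x'P a : a \in ~: P -> 0 <= x' a by rewrite inE oppr_ge0; exact: xN.
have x'N a : a \notin ~: P -> x' a <= 0 by rewrite inE negbK oppr_le0; exact: xP.
have x'd a : a \in ~: P -> x' a <= x' d by rewrite inE lerN2; exact: xd.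
have x'c a : a \notin ~: P -> x' c <= x' a by rewrite inE negbK lerN2; exact: xc.
have dP' : d \in ~: P by rewrite inE.
have cP' : c \notin ~: P by rewrite inE negbK.
have [P3|P3] := leqP #|P| 3.
  apply: small; exact: (small_side sg efg con brg cP dP xP xN xc xd good P3).
have [N3|N3] := leqP #|~: P| 3.
  apply: small; rewrite -qf_opp -sqnorm_opp.
  apply: (small_side sg efg con brg dP' cP' x'P x'N x'd x'c _ N3).
  have -> : ((f \in ~: P) != (g \in ~: P)) = ((f \in P) != (g \in P)).
    by rewrite !in_setC; case: (f \in P); case: (g \in P).
  by case/orP: good => [->//|/and4P[-> -> -> ->]]; rewrite orbT.
(* An added edge inside [P] puts the triangle on the wrong side; changing the sign of [x] exchanges
   the sides and preserves the form. *)
have [fgP|fgP] := boolP ((f \in P) && (f != c) && (g \in P) && (g != c)); last first.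
  apply: (large_sides efg con brg cP dP xP xN xc xd _ P3 N3 x0).
  move: fgP good; case: (f \in P); case: (g \in P) => //=; try by left.
    by rewrite !andbT => H /and4P[fc _ gc _]; rewrite fc gc in H.
  by move=> _ /and4P[_ fd _ gd]; right.
rewrite -qf_opp -sqnorm_opp.
apply: (large_sides efg con brg dP' cP' x'P x'N x'd x'c _ N3); rewrite ?setCK ?sqnorm_opp //.
by right; move: fgP; rewrite !in_setC !negbK => /andP[/andP[/andP[-> ->] ->] ->].
Qed.
End Comparison.

(** * Least eigenvalues of complements *)

Local Open Scope sesquilinear_scope.

(** The order of [algC] is total only on real elements; starting from a member of [s] keeps the
    minimum inside [s]. *)
Lemma bigmin_real_seq (s : seq algC) (h : algC) : h \in s ->
  {in s, forall z, z \is Num.real} ->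
  \big[Num.min/h]_(z <- s) z \in s /\
  {in s, forall z, \big[Num.min/h]_(z <- s) z <= z}.
Proof.
move=> hs sR.
have sub t : {subset t <= s} -> \big[Num.min/h]_(z <- t) z \in s /\
    {in t, forall z, \big[Num.min/h]_(z <- t) z <= z}.
  elim: t => [|a t IH] ts; first by rewrite big_nil.
  have [|m1 m2] := IH; first by move=> z zt; apply: ts; rewrite inE zt orbT.
  have as_ : a \in s by apply: ts; rewrite mem_head.
  rewrite big_cons; case: (real_leP (sR _ as_) (sR _ m1)) => le; split=> // z.
    rewrite inE => /orP[/eqP->//|/m2]; exact: le_trans.
  rewrite inE => /orP[/eqP->|/m2 //]; exact: ltW.
exact: sub.
Qed.

Lemma mem_spectrum n (A : 'M[algC]_n) z : (z \in spectrum A) = eigenvalue A z.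
Proof.
rewrite eigenvalue_root_char /spectrum; case: closed_field_poly_normal => /= s.
by rewrite (monicP (char_poly_monic A)) scale1r => ->; rewrite root_prod_XsubC.
Qed.

(** * Spectral theory of real symmetric matrices *)

Section Symmetric.
Variables (n : nat) (A : 'M[algC]_n).
Hypotheses (symA : A^T = A) (realA : A \is a mxOver Num.real).

Let hermA : A \is hermsymmx.
Proof.
apply: realsym_hermsym => //; apply/is_hermitianmxP.
by rewrite expr0 scale1r map_mx_id.
Qed.

Let P := spectralmx A.
Let D := spectral_diag A.

Let eqA : A = invmx P *m diag_mx D *m P.
Proof. exact/orthomx_spectralP/hermitian_normalmx. Qed.

Let PU : P \in unitmx. Proof. exact: spectral_unit. Qed.

Lemma spectral_diag_eigenvalue i : eigenvalue A (D 0 i).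
Proof.
apply/eigenvalueP; exists (row i P); last first.
  apply: contraTneq PU => r0; rewrite unitmxE unitfE negbK.
  by rewrite (expand_det_row _ i) big1 // => j _; have /rowP/(_ j) := r0; rewrite !mxE => ->; rewrite mul0r.
rewrite -row_mul eqA !mulmxA mulmxV // mul1mx row_mul.
by apply/rowP => j; rewrite row_diag_mx -scalemxAl -rowE !mxE.
Qed.

Lemma eigenvalue_real z : eigenvalue A z -> z \is Num.real.
Proof.
case/eigenvalueP => v Ev v0.
have [y y0 Ey] : exists2 y : 'rV_n, y != 0 & y *m diag_mx D = z *: y.
  exists (v *m invmx P); last by rewrite scalemxAl -Ev eqA !mulmxA mulmxK.
  by apply: contraNneq v0 => y0; rewrite -(mulmxKV PU v) y0 mul0mx.
have [i yi] : exists i, y 0 i != 0 by apply/rV0Pn.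
have := congr1 (fun M : 'rV_n => M 0 i) Ey; rewrite mul_mx_diag !mxE mulrC.
move/(mulIf yi) => <-; have := hermitian_spectral_diag_real hermA.
by move/mxOverP/(_ 0 i).
Qed.

(** In a unitary eigenbasis both sides are sums of the same squared moduli, weighted by [l] and by
    the eigenvalues. *)
Lemma rayleigh_lower (v : 'rV[algC]_n) l : (forall z, eigenvalue A z -> l <= z) ->
  l * (v *m v ^t*) 0 0 <= (v *m A *m v ^t*) 0 0.
Proof.
move=> ll; have UP : P \is unitarymx by exact: spectral_unitarymx.
pose y := v *m P ^t*.
have vy : v = y *m P by rewrite /y mulmxKtV.
have yt : v ^t* = P ^t* *m y ^t* by rewrite vy trmx_mul map_mxM.
have PPt : P *m P ^t* = 1%:M by apply/unitarymxP.
have -> : v *m v ^t* = y *m y ^t*.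
  by rewrite yt {1}vy mulmxA -(mulmxA y) PPt mulmx1.
have -> : v *m A *m v ^t* = y *m diag_mx D *m y ^t*.
  rewrite eqA invmx_unitary // -/y !mulmxA -/y yt !mulmxA.
  by rewrite -(mulmxA (y *m _)) PPt mulmx1.
rewrite !mxE big_distrr /=; apply: ler_sum => i _.
rewrite mul_mx_diag !mxE mulrAC [leRHS]mulrC ler_wpM2r ?mul_conjC_ge0 //.
exact/ll/spectral_diag_eigenvalue.
Qed.

Lemma lambda_min_eigenvalue : (0 < n)%N ->
  eigenvalue A (lambda_min A) /\ (forall z, eigenvalue A z -> lambda_min A <= z).
Proof.
move=> n0.
have hs : head 0 (spectrum A) \in spectrum A.
  have := spectral_diag_eigenvalue (Ordinal n0); rewrite -mem_spectrum.
  by case: spectrum => //= a s _; rewrite mem_head.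
have sR : {in spectrum A, forall z, z \is Num.real}.
  by move=> z; rewrite mem_spectrum; exact: eigenvalue_real.
have [m1 m2] := bigmin_real_seq hs sR.
by split=> [|z]; rewrite -mem_spectrum //; exact: m2.
Qed.

(** The real and imaginary parts of a complex eigenvector satisfy the same real equations, and one
    of them is nonzero. Entries in [algR] bring the ordered-field results into play. *)
Lemma real_eigenvector z : eigenvalue A z ->
  exists2 x : 'I_n -> algR, (exists i, x i != 0) &
    forall j, \sum_i (x i : algC) * A i j = z * x j.
Proof.
move=> ez; have zR := eigenvalue_real ez; case/eigenvalueP: ez => v Ev v0.
have AR i j : A i j \is Num.real by exact: (mxOverP realA).
have [i vi] : exists i, v 0 i != 0 by apply/rV0Pn.
have E j : \sum_i v 0 i * A i j = z * v 0 j.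
  by have := congr1 (fun M : 'rV_n => M 0 j) Ev; rewrite !mxE.
have [ri|ri] := eqVneq ('Re (v 0 i)) 0.
  exists (fun i => in_algR (Creal_Im (v 0 i))).
    exists i; apply: contraNneq vi => /(congr1 algRval) /= ii.
    by rewrite [v 0 i]Crect ri ii mulr0 addr0.
  move=> j /=; have := congr1 (fun u => 'Im u) (E j); rewrite raddf_sum (ImMl zR) => <-.
  by apply: eq_bigr => k _; exact: esym (ImMr (AR k j) (v 0 k)).
exists (fun i => in_algR (Creal_Re (v 0 i))).
  by exists i; apply: contraNneq ri => /(congr1 algRval)/eqP.
move=> j /=; have := congr1 (fun u => 'Re u) (E j); rewrite raddf_sum (ReMl zR) => <-.
by apply: eq_bigr => k _; exact: esym (ReMr (AR k j) (v 0 k)).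
Qed.
End Symmetric.

Section Complement.
Variables (n : nat) (e : rel 'I_n).
Hypotheses (sg : simple_graph e) (n0 : (0 < n)%N).
Let A := adjmx (gcompl e).

Lemma adjmx_sym : A^T = A.
Proof.
by case: sg => sE _; apply/matrixP => i j; rewrite !mxE /gcompl eq_sym sE.
Qed.

Lemma adjmx_real : A \is a mxOver Num.real.
Proof. by apply/mxOverP => i j; rewrite mxE realn. Qed.

Lemma gcompl_form (x : 'I_n -> algR) :
  \sum_i \sum_j (gcompl e i j)%:R * (x i * x j) = - qf e x - sqnorm x.
Proof.
rewrite /qf opprB -addrA -opprD expr2 big_distrl /= /sqnorm -big_split -sumrB /=.
apply: eq_bigr => i _; rewrite big_distrr /=.
have -> : x i ^+ 2 = \sum_j (j == i)%:R * (x i * x j).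
  by rewrite (bigD1 i) //= eqxx mul1r big1 ?addr0 // => j /negbTE->; rewrite mul0r.
rewrite -big_split -sumrB /=; apply: eq_bigr => j _; rewrite /gcompl (eq_sym j).
case: sg => _ iE; have [->|_] := eqVneq i j; first by rewrite iE /=; ring.
by case: (e i j); rewrite /=; ring.
Qed.

(** By [gcompl_form], lower bounds for the form of the complement are upper bounds for [qf e]; a
    real eigenvector of the least eigenvalue attains the bound. *)
Lemma lmin_gcompl : exists M : algR,
  [/\ lmin_graph (gcompl e) = algRval (- 1 - M), forall y, qf e y <= M * sqnorm y &
      exists2 x, 0 < sqnorm x & qf e x = M * sqnorm x].
Proof.
have [ev le] := lambda_min_eigenvalue adjmx_sym adjmx_real n0.
have lR := eigenvalue_real adjmx_sym adjmx_real ev.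
pose l := in_algR lR; exists (- 1 - l).
have form (x : 'I_n -> algR) (B : 'I_n -> 'I_n -> algR) : algRval (\sum_i \sum_j B i j * (x i * x j)) =
  \sum_j (\sum_i (x i : algC) * algRval (B i j)) * x j.
  rewrite exchange_big /= rmorph_sum; apply: eq_bigr => j _; rewrite big_distrl /= rmorph_sum.
  by apply: eq_bigr => i _; rewrite !rmorphM /= mulrCA mulrA.
split.
- by rewrite opprB addrCA subrr addr0.
- move=> y; pose v := \row_i (algRval (y i)).
  have := rayleigh_lower adjmx_sym adjmx_real v le.
  have -> : (v *m A *m v ^t*) 0 0 = algRval (- qf e y - sqnorm y).
    rewrite -gcompl_form form mxE; apply: eq_bigr => j _.
    rewrite !mxE (CrealP (algRvalP _)); congr (_ * _); apply: eq_bigr => i _.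
    by rewrite !mxE rmorph_nat.
  have -> : (v *m v ^t*) 0 0 = algRval (sqnorm y).
    by rewrite mxE rmorph_sum; apply: eq_bigr => j _; rewrite !mxE (CrealP (algRvalP _)) rmorphXn.
  rewrite -[lambda_min _]/(algRval l) -rmorphM => H.
  have {}H : l * sqnorm y <= - qf e y - sqnorm y by exact: H.
  lra.
have [x [i xi] Ex] := real_eigenvector adjmx_sym adjmx_real ev.
exists x.
  rewrite lt_neqAle sqnorm_ge0 andbT eq_sym; apply: contraNneq xi => /sqnorm_eq0 -> //.
suff : - qf e x - sqnorm x = l * sqnorm x by lra.
apply: val_inj; rewrite -gcompl_form /= form rmorph_sum mulr_sumr.
apply: eq_bigr => j _; rewrite rmorphXn /= expr2 mulrA -Ex; congr (_ * _).
by apply: eq_bigr => k _; rewrite rmorph_nat !mxE.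
Qed.
End Complement.

Theorem theorem3p4 (n : nat) (e : rel 'I_n) :
  (20 <= n)%N -> simple_graph e -> unicyclic e ->
  lmin_graph (gcompl (@Uext n)) <= lmin_graph (gcompl e) /\
  (lmin_graph (gcompl e) = lmin_graph (gcompl (@Uext n)) <-> gisomorphic e (@Uext n)).
Proof.
move=> n20 sg uni; have n0 : (0 < n)%N by rewrite (leq_trans _ n20).
have sgU : simple_graph (@Uext n).
  have [P [c [u [d [w [t1 [t2 [ok E _]]]]]]]] := Uext_double_star n20.
  have [sE iE] := double_star_simple ok.
  by split=> [a b|a]; rewrite !E.
have [M [EM ubM [x x0 Ex]]] := lmin_gcompl sg n0.
have [M' [EM' ubM' [z z0 Ez]]] := lmin_gcompl sgU n0.
have [le iso] := unicyclic_comparison n20 sg uni ubM' x0.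
have MM : M <= M' by rewrite Ex ler_pM2r in le.
rewrite EM EM'; split.
  by have : - 1 - M' <= - 1 - M by rewrite lerD2l lerN2.
split=> [/val_inj/addrI/oppr_inj E|[f [bf Hf]]].
  by apply: iso; rewrite Ex E.
(* For the converse, the isomorphism transports the maximizer [z] of the extremal graph to [e],
   whence [M' <= M]. *)
suff -> : M = M' by [].
apply/eqP; rewrite eq_le MM /=.
have := ubM (z \o f).
have -> : sqnorm (z \o f) = sqnorm z.
  by rewrite /sqnorm [RHS](reindex f) //; exact: onW_bij.
have -> : qf e (z \o f) = qf (@Uext n) z.
  rewrite /qf [X in _ = X - _](reindex f) /=; last exact: onW_bij.
  congr (_ - _ ^+ 2); last by rewrite [RHS](reindex f) //; exact: onW_bij.
  apply: eq_bigr => i _; rewrite [RHS](reindex f) /=; last exact: onW_bij.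
  by apply: eq_bigr => j _; rewrite Hf.
by rewrite Ez ler_pM2r.
Qed.
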